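(* Let $X$ be a separable Banach space with property $(M^* )$ and the metric compact approximation property. Then $\mathcal{K}(X)$ is an $M$-ideal in $\mathcal{L}(X)$.
   Context: $\mathcal{L}(X)$ is the Banach space of bounded linear operators on $X$ with the operator norm, $\mathcal{K}(X)$ its closed subspace of compact operators. A closed subspace $J$ of a Banach space $E$ is an $M$-ideal in $E$ if there is a subspace $V\subset E^*$ with $E^*=J^\perp\oplus_1 V$, i.e. every $e^*\in E^*$ is uniquely $e^*=j+v$ with $j\in J^\perp$ (annihilator of $J$), $v\in V$, and $\|e^*\|=\|j\|+\|v\|$. A separable Banach space $X$ has property $(M^* )$ if $\limsup_n\|u^*+x_n^*\|=\limsup_n\|v^*+x_n^*\|$ whenever $u^*,v^*\in X^*$, $\|u^*\|=\|v^*\|$, and $x_n^*\to0$ weak$^*$ in $X^*$. $X$ has the metric compact approximation property if there is a net of compact operators on $X$ of norm at most $1$ converging strongly (pointwise in norm) to the identity. *)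

(* Defs.v *)
From HB Require Import structures.
From mathcomp Require Import all_boot all_order all_algebra.
From mathcomp Require Import complex.
From mathcomp Require Import all_classical all_reals all_analysis.

Set Implicit Arguments.
Unset Strict Implicit.
Unset Printing Implicit Defensive.

Import Order.TTheory GRing.Theory Num.Theory.
Import numFieldNormedType.Exports.

Local Open Scope classical_set_scope.
Local Open Scope ring_scope.

(* Banach spaces are real or complex: [scalar_field R k] is R or R[i].  The
   norm of a normed module over [scalar_field R k] takes its values in
   [scalar_field R k]; these values are real, and [re] and [ofR] translate
   between them and R. *)
Inductive scalar_kind := RealScalars | ComplexScalars.

Definition scalar_field (R : realType) (k : scalar_kind) : numFieldType :=
  match k with
  | RealScalars => R : numFieldType
  | ComplexScalars => R[i] : numFieldType
  end.

Section scalar_field.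
Variable R : realType.

Definition re (k : scalar_kind) : scalar_field R k -> R :=
  match k return scalar_field R k -> R with
  | RealScalars => fun x => x
  | ComplexScalars => fun z => complex.Re z
  end.

Definition ofR (k : scalar_kind) : R -> scalar_field R k :=
  match k return R -> scalar_field R k with
  | RealScalars => fun x => x
  | ComplexScalars => fun x => real_complex R x
  end.

Variable k : scalar_kind.
Implicit Types (x y : R) (z w : scalar_field R k).

Lemma ofRK : cancel (@ofR k) (@re k).
Proof. by case: k. Qed.

Lemma reK z : z \is Num.real -> ofR k (re z) = z.
Proof. by case: k z => //= z /complex_realP[x ->]. Qed.

Lemma ofR0 : ofR k 0 = 0.
Proof. by case: k => //=; rewrite rmorph0. Qed.

Lemma ofRD x y : ofR k (x + y) = ofR k x + ofR k y.
Proof. by case: k => //=; rewrite rmorphD. Qed.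

Lemma ofRM x y : ofR k (x * y) = ofR k x * ofR k y.
Proof. by case: k => //=; rewrite rmorphM. Qed.

Lemma ler_ofR x y : (ofR k x <= ofR k y) = (x <= y).
Proof. by case: k => //=; rewrite lecR. Qed.

Lemma ofR_real x : ofR k x \is Num.real.
Proof. by case: k => [|/=]; [exact: num_real | apply/complex_realP; exists x]. Qed.

Lemma le_re z w : z <= w -> re z <= re w.
Proof. by case: k z w => //= z w; rewrite lecE => /andP[]. Qed.

End scalar_field.

Definition normR (R : realType) (k : scalar_kind)
  (V : normedModType (scalar_field R k)) (x : V) : R := re `|x|.

Lemma normRK (R : realType) (k : scalar_kind)
  (V : normedModType (scalar_field R k)) (x : V) : ofR k (normR x) = `|x|.
Proof. exact/reK/normr_real. Qed.

Section bounded_operators.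
Variables (R : realType) (k : scalar_kind).
Local Notation K := (scalar_field R k).

Definition bounded_operator_pred (U V : normedModType K) : {pred U -> V} :=
  mem [set f : U -> V | linear f /\ continuous f].

Record bounded_operator (U V : normedModType K) := BoundedOperator {
  operator_fun :> U -> V;
  operator_funP : operator_fun \in @bounded_operator_pred U V
}.

Section module.
Variables U V : normedModType K.
Local Notation B := (bounded_operator U V).

HB.instance Definition _ := [isSub for @operator_fun U V].
HB.instance Definition _ := [Choice of B by <:].

Lemma bounded_operator_submod_closed :
  submod_closed (@bounded_operator_pred U V).
Proof.
split=> [|a f g]; rewrite !inE.
  split=> [b x y|x]; first by rewrite /= scaler0 addr0.
  exact: cvg_cst.
move=> [lf cf] [lg cg]; split=> [b x y|x].
  change (a *: f (b *: x + y) + g (b *: x + y) =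
    b *: (a *: f x + g x) + (a *: f y + g y)).
  by rewrite lf lg !scalerDr addrACA !scalerA mulrC.
by apply: cvgD; [apply: cvgZl_tmp; exact: cf|exact: cg].
Qed.

HB.instance Definition _ := GRing.isSubmodClosed.Build _ _
  (@bounded_operator_pred U V) bounded_operator_submod_closed.
HB.instance Definition _ := [SubChoice_isSubLmodule of B by <:].

Lemma operator_linear (f : B) : linear f.
Proof. by have := operator_funP f; rewrite inE => -[]. Qed.

HB.instance Definition _ (f : B) :=
  GRing.isLinear.Build K U V *:%R (operator_fun f) (operator_linear f).

Lemma operator_continuous (f : B) : continuous f.
Proof. by have := operator_funP f; rewrite inE => -[]. Qed.

Lemma operatorD (f g : B) x : (f + g) x = f x + g x.
Proof. by []. Qed.

Lemma operatorZ a (f : B) x : (a *: f) x = a *: f x.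
Proof. by []. Qed.

Lemma operator_eqP (f g : B) : f =1 g -> f = g.
Proof. by move=> fg; apply/val_inj/funext. Qed.

Definition operator_norm (f : B) : K :=
  ofR k (sup [set normR (f x) | x in [set x : U | `|x| <= 1]]).

Lemma has_sup_operator_norm (f : B) :
  has_sup [set normR (f x) | x in [set x : U | `|x| <= 1]].
Proof.
split; first by exists (normR (f 0)), 0 => //=; rewrite normr0.
have /bounded_funP/(_ 1)[M fM] : bounded_near (f : {linear U -> V}) (nbhs 0).
  exact/linear_bounded_continuous/operator_continuous.
by exists (re M) => _ [x /fM fxM <-]; exact: le_re.
Qed.

Lemma ler_operator_norm1 (f : B) (x : U) : `|x| <= 1 -> `|f x| <= operator_norm f.
Proof.
move=> x1; rewrite -normRK ler_ofR; apply: ub_le_sup; last by exists x.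
exact: (has_sup_operator_norm f).2.
Qed.

Lemma operator_norm_le (f : B) (M : K) : M \is Num.real ->
  (forall x : U, `|x| <= 1 -> `|f x| <= M) -> operator_norm f <= M.
Proof.
move=> Mr fM; rewrite -(reK Mr) ler_ofR; apply: ge_sup.
  exact: (has_sup_operator_norm f).1.
by move=> _ [x x1 <-]; exact/le_re/fM.
Qed.

Lemma operator_norm_real (f : B) : operator_norm f \is Num.real.
Proof. exact: ofR_real. Qed.

Lemma operator_normD (f g : B) :
  operator_norm (f + g) <= operator_norm f + operator_norm g.
Proof.
apply: operator_norm_le => [|x x1]; first by rewrite rpredD// operator_norm_real.
by rewrite operatorD (le_trans (ler_normD _ _))// lerD// ler_operator_norm1.
Qed.

Lemma operator_normZ_le (a : K) (f : B) :
  operator_norm (a *: f) <= `|a| * operator_norm f.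
Proof.
apply: operator_norm_le => [|x x1].
  by rewrite rpredM// ?normr_real// operator_norm_real.
by rewrite operatorZ normrZ ler_wpM2l// ler_operator_norm1.
Qed.

Lemma operator_norm_ge0 (f : B) : 0 <= operator_norm f.
Proof. by rewrite (le_trans _ (@ler_operator_norm1 f 0 _)) ?normr0 ?ler01. Qed.

Lemma operator_normZ (a : K) (f : B) :
  operator_norm (a *: f) = `|a| * operator_norm f.
Proof.
apply/eqP; rewrite eq_le operator_normZ_le/=.
have [->|a0] := eqVneq a 0; first by rewrite normr0 mul0r operator_norm_ge0.
rewrite -ler_pdivlMl ?normr_gt0// -normfV.
by rewrite (le_trans _ (operator_normZ_le _ _))// scalerA mulVf// scale1r.
Qed.

Lemma operator_norm_eq0 (f : B) : operator_norm f = 0 -> f = 0.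
Proof.
move=> f0; apply: operator_eqP => x /=; have [->|x0] := eqVneq x 0.
  by rewrite !linear0.
have: `|f (`|x|^-1 *: x)| <= 0.
  by rewrite -f0 ler_operator_norm1// normrZ normfV normr_id mulVf// normr_eq0.
by rewrite normr_le0 linearZ/= scaler_eq0 invr_eq0 normr_eq0 (negPf x0) => /eqP.
Qed.

HB.instance Definition _ := Lmodule_isNormed.Build K B
  operator_normD operator_normZ operator_norm_eq0.

End module.
End bounded_operators.

Notation "''L' ( U , V )" := (bounded_operator U V)
  (at level 8, format "''L' ( U ,  V )") : type_scope.

Section banach.
Variables (R : realType) (k : scalar_kind).
Local Notation K := (scalar_field R k).

Definition dual_space (E : normedModType K) : normedModType K := 'L(E, K^o).

Definition compact_operator (U V : normedModType K) (T : 'L(U, V)) : Prop :=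
  precompact (T @` [set x : U | `|x| <= 1]).

Definition compact_operators (X : normedModType K) : set 'L(X, X) :=
  [set T | compact_operator T].

Definition linear_subspace (E : lmodType K) (J : set E) : Prop :=
  J 0 /\ forall (a : K) (x y : E), J x -> J y -> J (a *: x + y).

Definition annihilator (E : normedModType K) (J : set E) : set (dual_space E) :=
  [set f : dual_space E | forall x : E, J x -> f x = 0].

(* E is the l1-direct sum of the subspaces V and W *)
Definition l1_direct_sum (E : normedModType K) (V W : set E) : Prop :=
  (forall e : E, exists! p : E * E, [/\ V p.1, W p.2 & e = p.1 + p.2]) /\
  (forall v w : E, V v -> W w -> `|v + w| = `|v| + `|w|).

Definition M_ideal (E : normedModType K) (J : set E) : Prop :=
  [/\ linear_subspace J, closed J &
    exists2 V : set (dual_space E),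
      linear_subspace V & l1_direct_sum (annihilator J) V].

Definition separable_space (E : topologicalType) : Prop :=
  exists2 D : set E, countable D & dense D.

Definition weak_star_cvg0 (X : normedModType K) (xs : nat -> dual_space X) : Prop :=
  forall x : X, (fun n => xs n x : K^o) @ \oo --> (0 : K^o).

Definition property_Mstar (X : normedModType K) : Prop :=
  forall (u v : dual_space X) (xs : nat -> dual_space X),
    `|u| = `|v| -> weak_star_cvg0 xs ->
    limn_esup (fun n => (normR (u + xs n))%:E) =
    limn_esup (fun n => (normR (v + xs n))%:E).

Definition directed (I : Type) (le : I -> I -> Prop) : Prop :=
  [/\ inhabited I, forall i, le i i,
      forall i j l, le i j -> le j l -> le i l &
      forall i j, exists l, le i l /\ le j l].

(* the filter generated by the tails of a net *)
Definition tails (I : Type) (le : I -> I -> Prop) : set_system I :=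
  filter_from [set: I] (fun i => [set j | le i j]).

Definition metric_compact_approximation_property (X : normedModType K) : Prop :=
  exists (I : Type) (le : I -> I -> Prop) (T : I -> 'L(X, X)),
    [/\ directed le, forall i, compact_operator (T i), forall i, `|T i| <= 1 &
        forall x : X, (fun i => T i x) @ tails le --> x].

End banach.

Arguments compact_operators {R k} X.

(* Main.v *)
(* For compact operators L of norm at most 1 that tend strongly to the identity,
   let P phi be the limit of T |-> phi (L T) along an ultrafilter.  P is a
   projection of L(X)* whose kernel is the annihilator of K(X), and the claim is
   that |P phi| + |phi - P phi| <= |phi|.  Testing P phi on S and phi - P phi on
   T, with |S| <= 1 and |T| = 1, it suffices to find such an L, in a prescribed
   closed convex set, with |T + L (S - T)| <= 1 + e.  Simons' inequality reduces
   this to an estimate along functionals f_i of norm at most 1 that tend weak* to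
   a functional F, where
     f_i (T + L (S - T)) ~ F S + (f_i - F) T + (F L - F) (S - T).
   By property M* the first two terms together have norm at most about 1, and the
   last term tends weakly to 0 as L tends to the identity.  The latter also rests
   on M*: if |u + z_n| <= |u| and z_n -> 0 weak*, then the sums of sparse
   subsequences of (z_n) stay bounded by about |u|, so that no bounded additive q
   can satisfy inf_n q (z_n) > 0. *)
Require Import Defs.
From HB Require Import structures.
From mathcomp Require Import all_boot all_order all_algebra.
From mathcomp Require Import complex ring lra.
From mathcomp Require Import all_classical all_reals all_analysis.

Set Implicit Arguments.
Unset Strict Implicit.
Unset Printing Implicit Defensive.

Import Order.TTheory GRing.Theory Num.Theory.
Import numFieldNormedType.Exports.

Local Open Scope classical_set_scope.
Local Open Scope ring_scope.

(** * Scalars and norms *)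

Section scalars.
Variables (R : realType) (k : scalar_kind).
Local Notation K := (scalar_field R k).
Implicit Types (t : R) (z w : K).

Lemma reD z w : re (z + w) = re z + re w.
Proof. by case: k z w => //= z w; rewrite raddfD. Qed.

Lemma reN z : re (- z) = - re z.
Proof. by case: k z => //= z; rewrite raddfN. Qed.

Lemma reB z w : re (z - w) = re z - re w.
Proof. by rewrite reD reN. Qed.

Lemma re_ofRM t z : re (ofR k t * z) = t * re z.
Proof. by case: k z => //= -[a b] /=; rewrite mul0r subr0. Qed.

Lemma ofR1 : ofR k (1 : R) = 1.
Proof. by case: k. Qed.

Lemma ofRN t : ofR k (- t) = - ofR k t.
Proof. by case: k => //=; rewrite rmorphN. Qed.

Lemma ltr_ofR t s : (ofR k t < ofR k s) = (t < s).
Proof. by case: k => //=; rewrite ltcR. Qed.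

Lemma ofR_norm t : `|ofR k t| = ofR k `|t|.
Proof. by case: k => //=; rewrite normc_def /= expr0n /= addr0 sqrtr_sqr. Qed.

Section normed_module.
Variable V : normedModType K.
Implicit Types x y v : V.

Lemma normR_ge0 x : 0 <= normR x.
Proof. by rewrite -(ler_ofR k) ofR0 normRK. Qed.

Lemma normR0 : normR (0 : V) = 0.
Proof. by rewrite /normR normr0 -(ofR0 R k) ofRK. Qed.

Lemma normR0_eq0 x : normR x = 0 -> x = 0.
Proof. by move=> x0; apply/normr0_eq0; rewrite -normRK x0 ofR0. Qed.

Lemma normR_eq0 x : (normR x == 0) = (x == 0).
Proof. by apply/eqP/eqP => [/normR0_eq0//|->]; exact: normR0. Qed.

Lemma ler_normRD x y : normR (x + y) <= normR x + normR y.
Proof. by rewrite -(ler_ofR k) ofRD !normRK ler_normD. Qed.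

Lemma normRN x : normR (- x) = normR x.
Proof. by rewrite /normR normrN. Qed.

Lemma distRC x y : normR (x - y) = normR (y - x).
Proof. by rewrite /normR distrC. Qed.

Lemma ler_normRB x y : normR (x - y) <= normR x + normR y.
Proof. by rewrite (le_trans (ler_normRD _ _))// normRN. Qed.

Lemma ler_distRD y x v : normR (x - v) <= normR (x - y) + normR (y - v).
Proof. by rewrite (le_trans _ (ler_normRD _ _))// addrA subrK. Qed.

Lemma normRZ z x : normR (z *: x) = normR (z : K^o) * normR x.
Proof.
by apply: (can_inj (@ofRK R k)); rewrite ofRM !normRK normrZ.
Qed.

Lemma normR_ofR t : normR (ofR k t : K^o) = `|t|.
Proof. by rewrite /normR ofR_norm ofRK. Qed.

Lemma normRZ_ofR t x : normR (ofR k t *: x) = `|t| * normR x.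
Proof. by rewrite normRZ normR_ofR. Qed.

Lemma normR_le1 x : (`|x| <= 1) = (normR x <= 1).
Proof. by rewrite -normRK -ofR1 ler_ofR. Qed.

Lemma normR_gt0 x : (0 < normR x) = (x != 0).
Proof. by rewrite lt_def normR_eq0 normR_ge0 andbT. Qed.

Lemma cvg_normRP {I : Type} {F : set_system I} {FF : Filter F} (f : I -> V) l :
  f @ F --> l <-> forall e : R, 0 < e -> \forall i \near F, normR (f i - l) < e.
Proof.
split=> [/cvgrPdist_lt fl e e0|fl].
  have := fl (ofR k e); rewrite -(ofR0 R k) ltr_ofR => /(_ e0).
  by apply: filterS => i; rewrite -normRK ltr_ofR distRC.
apply/cvgrPdist_lt => e e0; have eR : e \is Num.real by exact: gtr0_real.
have e0' : 0 < re e by rewrite -(ltr_ofR) ofR0 reK.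
by near=> i; rewrite -normRK -(reK eR) ltr_ofR distRC; near: i; exact: fl.
Unshelve. all: by end_near. Qed.

(** [ofR k s *: x + y] is the convex combination of [x + y] and [- x + y] with weights (1 + s)/2 and
    (1 - s)/2. This lets property M* pass from equal norms to an inequality of norms. *)
Lemma normR_segment x y (s M : R) : 0 <= s <= 1 ->
  normR (x + y) <= M -> normR (- x + y) <= M -> normR (ofR k s *: x + y) <= M.
Proof.
move=> /andP[s0 s1] xyM NxyM.
have -> : ofR k s *: x + y =
    ofR k ((1 + s) / 2) *: (x + y) + ofR k ((1 - s) / 2) *: (- x + y).
  rewrite !scalerDr addrACA scalerN -scalerBl -scalerDl.
  have -> : ofR k ((1 + s) / 2) - ofR k ((1 - s) / 2) = ofR k s.
    by rewrite -ofRN -ofRD; congr ofR; lra.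
  have -> : ofR k ((1 + s) / 2) + ofR k ((1 - s) / 2) = 1.
    by rewrite -ofRD -ofR1; congr ofR; lra.
  by rewrite scale1r.
rewrite (le_trans (ler_normRD _ _))// !normRZ_ofR.
rewrite !ger0_norm; [|lra|lra].
rewrite (@le_trans _ _ ((1 + s) / 2 * M + (1 - s) / 2 * M))//; last lra.
by rewrite lerD// ler_wpM2l//; lra.
Qed.

End normed_module.

Lemma normRM z w : normR (z * w : K^o) = normR (z : K^o) * normR (w : K^o).
Proof. exact: (@normRZ K^o z w). Qed.

Lemma ler_re_normR z : re z <= normR (z : K^o).
Proof.
have : re z <= `|re z| by exact: ler_norm.
move/le_trans; apply; rewrite -(ler_ofR k) normRK.
by case: k z => //= z; exact: normc_ge_Re.
Qed.

Lemma ler_norm_re z : `|re z| <= normR (z : K^o).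
Proof.
by rewrite ler_norml ler_re_normR andbT lerNl -reN -(@normRN K^o) ler_re_normR.
Qed.

Lemma rotation z : exists2 w, normR (w : K^o) = 1 & w * z = ofR k (normR (z : K^o)).
Proof.
have [->|z0] := eqVneq z 0.
  exists 1; last by rewrite mulr0 (@normR0 K^o) ofR0.
  by rewrite -ofR1 normR_ofR normr1.
exists (ofR k (normR (z : K^o)) / z); last by rewrite divfK.
rewrite normRM normR_ofR /normR normfV ger0_norm ?normR_ge0//.
apply: (can_inj (@ofRK R k)); rewrite ofRM normRK reK ?ofR1; last first.
  by rewrite realV normr_real.
by rewrite divff// normr_eq0.
Qed.

(** The image filter extends to an ultrafilter [G], which converges by compactness. If the preimage
    of a neighbourhood of the limit were not in [U], its complement would be, and [G] would contain
    two disjoint sets. *)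
Lemma ultra_cvg_compact (I : Type) (U : set_system I) (T : topologicalType)
  (f : I -> T) (A : set T) : UltraFilter U -> compact A -> (forall i, A (f i)) ->
  exists l : T, f @ U --> l.
Proof.
move=> UU; rewrite compact_ultra => cA fA.
have [G [GU fUG]] := ultraFilterLemma (fmap_proper_filter f (ultra_proper (F := U))).
have [l [_ Gl]] := cA G GU (fUG _ (filterS (fun i _ => fA i) filterT)).
exists l => V Vl; have [//|UV] := in_ultra_setVsetC (f @^-1` V) UU.
have : G set0 by rewrite -(setICr V); apply: filterI; [exact: Gl|exact: fUG].
by move/(@filter_not_empty _ _ (ultra_proper (F := G))).
Qed.

End scalars.

Lemma ultra_cvg (R : realType) (k : scalar_kind) (I : Type) (U : set_system I)
    (f : I -> scalar_field R k) (M : R) : UltraFilter U ->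
  (forall i, normR (f i : (scalar_field R k)^o) <= M) ->
  exists l : (scalar_field R k)^o, (f : I -> (scalar_field R k)^o) @ U --> l.
Proof.
move=> UU fM; have FU := @ultra_proper _ _ UU.
have cvg_real (g : I -> R) : (forall i, `|g i| <= M) -> exists l : R, g @ U --> l.
  move=> gM; apply: (@ultra_cvg_compact _ U _ g `[- M, M] UU (@segment_compact _ _ _)).
  by move=> i; rewrite /= in_itv /= -ler_norml.
case: k f fM => f fM; first exact: cvg_real.
have normRi : normR ('i%C : (scalar_field R ComplexScalars)^o) = 1.
  by rewrite /= expr0n /= add0r expr1n sqrtr1.
have [a fa] := cvg_real _ (fun i => le_trans (@ler_norm_re R ComplexScalars (f i)) (fM i)).
have [|b fb] := cvg_real (fun i => complex.Im (f i)).
  (* Up to sign the imaginary part is the real part of ['i%C * f i], so the bound on real parts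
     applies. *)
  move=> i; apply: le_trans (fM i); rewrite -[leRHS]mul1r -normRi -normRM.
  rewrite (le_trans _ (@ler_norm_re R ComplexScalars _))//.
  by case: (f i) => c d /=; rewrite mul0r mul1r sub0r normrN.
exists (a +i* b)%C; apply/cvg_normRP => e e0.
move/cvgrPdist_lt: fa => /(_ (e / 2)) fa; move/cvgrPdist_lt: fb => /(_ (e / 2)) fb.
near=> i; have -> : f i - (a +i* b)%C = ofR ComplexScalars (complex.Re (f i) - a) +
    'i%C * ofR ComplexScalars (complex.Im (f i) - b).
  by case: (f i) => c d; apply/eqP; rewrite eq_complex /=; apply/andP; split; apply/eqP; lra.
rewrite (le_lt_trans (@ler_normRD _ ComplexScalars _ _ _))// normRM.
rewrite normRi mul1r !(@normR_ofR R ComplexScalars) (splitr e) ltrD//; rewrite distrC; near: i.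
  by apply: fa; rewrite divr_gt0.
by apply: fb; rewrite divr_gt0.
Unshelve. all: by end_near. Qed.

(** * Bounded operators *)

Section operators.
Variables (R : realType) (k : scalar_kind).
Local Notation K := (scalar_field R k).

Section operator_norm.
Variables U V : normedModType K.
Implicit Types f g : 'L(U, V).

Lemma operatorB f g x : (f - g) x = f x - g x. Proof. by []. Qed.

Lemma normR_operator_le1 f (x : U) : normR x <= 1 -> normR (f x) <= normR f.
Proof.
by move=> x1; rewrite -(ler_ofR k) !normRK; apply: ler_operator_norm1; rewrite normR_le1.
Qed.

Lemma normR_operator_le f (x : U) : normR (f x) <= normR f * normR x.
Proof.
have [->|x0] := eqVneq x 0; first by rewrite linear0 !normR0 mulr0.
have nx0 : 0 < normR x by rewrite normR_gt0.
rewrite -ler_pdivrMr// mulrC -[_^-1]ger0_norm ?invr_ge0 ?normR_ge0//.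
rewrite -normRZ_ofR -linearZ; apply: normR_operator_le1.
by rewrite normRZ_ofR ger0_norm ?invr_ge0 ?normR_ge0// mulVf// gt_eqF.
Qed.

Lemma normR_operator_ub f (M : R) :
  (forall x : U, normR x <= 1 -> normR (f x) <= M) -> normR f <= M.
Proof.
move=> fM; rewrite -(ler_ofR k) normRK.
apply: operator_norm_le => [|x]; first exact: ofR_real.
by rewrite normR_le1 -normRK ler_ofR; exact: fM.
Qed.

Lemma normR_operator_approx f (e : R) : 0 < e ->
  exists2 x : U, normR x <= 1 & normR f - e < normR (f x).
Proof.
move=> e0; apply/not_exists2P => fe.
have : normR f <= normR f - e; last by apply/negP; rewrite -ltNge ltrBlDr ltrDl.
apply: normR_operator_ub => x x1.
by rewrite leNgt; apply/negP => fx; have [] := fe x.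
Qed.

Lemma bounded_operator_exists (F : U -> V) (M : R) : linear F ->
  (forall x, normR (F x) <= M * normR x) -> exists f : 'L(U, V), f =1 F.
Proof.
move=> lF FM; suff cF : continuous F.
  have FP : F \in @bounded_operator_pred R k U V by rewrite inE.
  by exists (BoundedOperator FP).
pose Flin := GRing.isLinear.Build K U V *:%R F lF.
pose F' : {linear U -> V} := HB.pack F Flin.
apply: (proj1 (linear_bounded_continuous F')).
apply/(bounded_funP F') => r; exists (ofR k (`|M| * `|re r|)) => x xr.
rewrite -normRK ler_ofR (le_trans (FM x))//.
rewrite (le_trans (ler_wpM2r (normR_ge0 x) (ler_norm M)))// ler_wpM2l//.
by rewrite (le_trans _ (ler_norm _))//; exact: le_re.
Qed.

End operator_norm.

(** Pointwise limits exist since [V] is complete; the Cauchy bound passes to them, which gives both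
    boundedness of the limit and convergence in norm. *)
Lemma operator_cvg (U : normedModType K) (V : completeNormedModType K)
    (f : nat -> 'L(U, V)) :
  (forall e : R, 0 < e -> exists N, forall n, (N <= n)%N -> normR (f n - f N) <= e) ->
  exists g : 'L(U, V), f @ \oo --> g.
Proof.
move=> cf.
have fcvg x : exists l : V, f n x @[n --> \oo] --> l.
  apply/cvg_ex; apply: (@cauchy_cvg V). apply: (@cauchy_exP K V) => e e0.
  have eR : e \is Num.real by exact: gtr0_real.
  have nx1 : 0 < normR x + 1 by rewrite ltr_wpDl// normR_ge0.
  have e0' : 0 < re e / (normR x + 1).
    by rewrite divr_gt0// -(ltr_ofR k) ofR0 reK.
  have [N fN] := cf _ e0'; exists (f N x); exists N => // n /= Nn.
  rewrite -ball_normE /= -normRK -(reK eR) ltr_ofR distRC -operatorB.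
  rewrite (le_lt_trans (normR_operator_le _ _))//.
  rewrite (le_lt_trans (ler_wpM2r (normR_ge0 x) (fN _ Nn)))//.
  rewrite -mulrA gtr_pMr; last by rewrite -(ltr_ofR k) ofR0 reK.
  by rewrite mulrC ltr_pdivrMr// mul1r ltrDl.
have /choice[G fG] := fcvg.
have GN e N : (forall n, (N <= n)%N -> normR (f n - f N) <= e) ->
    forall x, normR (G x - f N x) <= e * normR x.
  move=> fN x; apply/ler_addgt0Pr => d d0.
  have /cvg_normRP/(_ d d0)[M _ fM] := fG x.
  have := fM (maxn N M) (leq_maxr _ _) => /= fGd.
  rewrite (le_trans (ler_distRD (f (maxn N M) x) _ _))// addrC lerD//.
    rewrite -operatorB (le_trans (normR_operator_le _ _))//.
    by rewrite ler_wpM2r ?normR_ge0// fN// leq_maxl.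
  by rewrite distRC ltW.
have lG : linear G.
  move=> a x y; apply: (@cvg_unique _ (@norm_hausdorff _ V) _ _ _ _ (fG _)).
  rewrite (_ : (fun _ => _) = (fun n => a *: f n x + f n y)).
    by apply: cvgD => //; apply: cvgZl_tmp.
  by apply/funext => n; rewrite linearP.
have [N fN] := cf 1 ltr01.
have [|g gG] := bounded_operator_exists (M := 1 + normR (f N)) lG.
  move=> x; rewrite -[G x](subrK (f N x)) (le_trans (ler_normRD _ _))// mulrDl.
  by rewrite lerD ?normR_operator_le// GN.
exists g; apply/cvg_normRP => e e0.
have e3 : 0 < e / 3 by rewrite divr_gt0.
have [M fM] := cf _ e3; exists M => // n /= Mn.
rewrite (@le_lt_trans _ _ (e / 3 + e / 3))//; last lra.
rewrite (le_trans (ler_distRD (f M) _ _))// lerD ?fM// distRC.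
apply: normR_operator_ub => x x1; rewrite operatorB gG.
rewrite (le_trans (GN _ _ fM x))// ler_piMr//; exact: ltW.
Qed.

Section composition.
Variables U V W : normedModType K.

Lemma comp_operator_subproof (f : 'L(V, W)) (g : 'L(U, V)) :
  (f \o g) \in @bounded_operator_pred R k U W.
Proof.
rewrite inE; split=> [a x y|x]; first by rewrite /= !linearP.
by apply: continuous_comp; exact: operator_continuous.
Qed.

Definition comp_operator (f : 'L(V, W)) (g : 'L(U, V)) : 'L(U, W) :=
  BoundedOperator (comp_operator_subproof f g).

Lemma normR_comp_operator (f : 'L(V, W)) (g : 'L(U, V)) :
  normR (comp_operator f g) <= normR f * normR g.
Proof.
apply: normR_operator_ub => x x1; apply: (le_trans (normR_operator_le f (g x))).
by rewrite ler_wpM2l ?normR_ge0// normR_operator_le1.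
Qed.

Lemma comp_operatorPl (a : K) (f g : 'L(V, W)) (h : 'L(U, V)) :
  comp_operator (a *: f + g) h = a *: comp_operator f h + comp_operator g h.
Proof. exact: operator_eqP. Qed.

Lemma comp_operatorPr (a : K) (f : 'L(V, W)) (g h : 'L(U, V)) :
  comp_operator f (a *: g + h) = a *: comp_operator f g + comp_operator f h.
Proof. by apply: operator_eqP => x /=; rewrite linearP. Qed.

Lemma comp_operatorBr (f : 'L(V, W)) (g h : 'L(U, V)) :
  comp_operator f (g - h) = comp_operator f g - comp_operator f h.
Proof. by apply: operator_eqP => x /=; rewrite linearB. Qed.

End composition.
End operators.

(** * Compact operators *)

Section filters.

Lemma near_seq (I : Type) (F : set_system I) (FF : Filter F) (T : eqType)
    (s : seq T) (P : T -> I -> Prop) :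
  (forall y, y \in s -> \forall i \near F, P y i) ->
  \forall i \near F, forall y, y \in s -> P y i.
Proof.
elim: s => [_|y s IH sP]; first by apply: nearW.
have Ps : \forall i \near F, forall z, z \in s -> P z i.
  by apply: IH => z zs; apply: sP; rewrite inE zs orbT.
have Py := sP y (mem_head _ _).
by near=> i => z; rewrite inE => /predU1P[->|]; [near: i|move: (z); near: i].
Unshelve. all: by end_near. Qed.

Lemma ultra_seq (I : Type) (U : set_system I) (T : eqType)
    (s : seq T) (P : T -> set I) : UltraFilter U ->
  U [set i | exists2 y, y \in s & P y i] -> exists2 y, y \in s & U (P y).
Proof.
move=> UU; have FU := @ultra_proper _ _ UU.
move=> UP; apply/not_exists2P => nP.
have : \forall i \near U, forall y, y \in s -> ~ P y i.
  apply: near_seq => y ys; have [UPy|//] := in_ultra_setVsetC (P y) UU.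
  by have [] := nP y.
move=> /(filterI UP)/(@filter_ex _ _ FU)[i [[y ys Py] nPi]].
exact: nPi Py.
Qed.

End filters.

Section compact_operators.
Variables (R : realType) (k : scalar_kind).
Local Notation K := (scalar_field R k).

(** Total boundedness characterizes precompactness in a complete space. For the converse direction,
    an ultrafilter on the closure contains a small ball around some point of each finite net, so it
    is Cauchy and converges. *)
Lemma compact_operatorP (U : normedModType K) (V : completeNormedModType K)
    (T : 'L(U, V)) :
  compact_operator T <-> forall e : R, 0 < e -> exists s : seq V,
    forall x, normR x <= 1 -> exists2 y, y \in s & normR (T x - y) <= e.
Proof.
rewrite /compact_operator precompactE; split=> [|Tnet].
  rewrite compact_cover => cT e e0.
  have [|y Ty|D _ TD] := cT V setT (fun y => [set z | normR (z - y) < e]).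
  - move=> y _; rewrite (_ : [set _ | _] = ball y (ofR k e)); last first.
      by apply/seteqP; split=> z; rewrite -ball_normE /= distrC -normRK ltr_ofR.
    by apply: ball_open; rewrite -(ofR0 R k) ltr_ofR.
  - by exists y => //=; rewrite subrr normR0.
  exists (finmap.enum_fset D) => x x1; have [|y Dy /ltW xy] := TD (T x); last by exists y.
  by apply: subset_closure; exists x => //=; rewrite normR_le1.
rewrite compact_ultra => F FU FT; have FP := @ultra_proper _ _ FU.
suff cF : cauchy F.
  have /cvg_ex[l Fl] := @cauchy_cvg V F FP cF.
  exists l; split => //; apply: closed_closure => B lB.
  exact: filter_ex (filterI FT (Fl B lB)).
apply: (@cauchy_exP K V) => e e0; have eR : e \is Num.real by exact: gtr0_real.
have e0' : 0 < re e by rewrite -(ltr_ofR k) ofR0 reK.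
have [|s sT] := Tnet (re e / 3); first by rewrite divr_gt0.
have [|y ys Fy] := @ultra_seq V F V s (fun y => ball y e) FU; last by exists y.
apply: filterS FT => z /(_ [set y | normR (y - z) < re e / 3])[|_ [[x x1 <-] Txz]].
  rewrite (_ : [set _ | _] = ball z (ofR k (re e / 3))); last first.
    by apply/seteqP; split=> y; rewrite -ball_normE /= distrC -normRK ltr_ofR.
  by apply: nbhsx_ballx; rewrite -(ofR0 R k) ltr_ofR divr_gt0.
have [|y ys Txy] := sT x; first by rewrite -normR_le1.
exists y => //; rewrite -ball_normE /= -normRK -(reK eR) ltr_ofR distRC.
rewrite (le_lt_trans (ler_distRD (T x) _ _))// distRC.
rewrite (@lt_le_trans _ _ (re e / 3 + re e / 3))//; last lra.
exact: ltr_leD.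
Qed.

Lemma compact_operator_linear_subspace (X : completeNormedModType K) :
  linear_subspace (compact_operators X).
Proof.
split=> [|a T1 T2 /compact_operatorP cT1 /compact_operatorP cT2].
  apply/compact_operatorP => e e0; exists [:: 0] => x _.
  by exists 0; rewrite ?inE// subr0 normR0 ltW.
apply/compact_operatorP => e e0.
have a1 : 0 < normR (a : K^o) + 1 by rewrite ltr_wpDl// normR_ge0.
have [|s1 sT1] := cT1 (e / 2 / (normR (a : K^o) + 1)); first by rewrite !divr_gt0.
have [|s2 sT2] := cT2 (e / 2); first by rewrite !divr_gt0.
exists [seq a *: y1 + y2 | y1 <- s1, y2 <- s2] => x x1.
have [y1 ys1 T1y] := sT1 x x1; have [y2 ys2 T2y] := sT2 x x1.
exists (a *: y1 + y2); first exact: allpairs_f.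
rewrite operatorD operatorZ opprD addrACA -scalerBr (splitr e).
rewrite (le_trans (ler_normRD _ _))// lerD// normRZ.
rewrite (@le_trans _ _ ((normR (a : K^o) + 1) * normR (T1 x - y1)))//.
  by rewrite ler_wpM2r ?normR_ge0// lerDl.
by rewrite mulrC -ler_pdivlMr.
Qed.

Lemma closed_compact_operators (X : completeNormedModType K) :
  closed (compact_operators X).
Proof.
move=> T clT; apply/compact_operatorP => e e0.
have [|S [cS ST]] := clT (ball T (ofR k (e / 2))).
  by apply: nbhsx_ballx; rewrite -(ofR0 R k) ltr_ofR divr_gt0.
move: ST; rewrite -ball_normE /= -normRK ltr_ofR => ST.
have [|s sS] := (compact_operatorP S).1 cS (e / 2); first by rewrite divr_gt0.
exists s => x x1; have [y ys Sxy] := sS x x1; exists y => //.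
rewrite (splitr e) (le_trans (ler_distRD (S x) _ _))// lerD// -operatorB.
by rewrite (le_trans (normR_operator_le1 _ x1))// ltW.
Qed.

Lemma compact_comp_operator (X : completeNormedModType K) (L T : 'L(X, X)) :
  compact_operator L -> compact_operator (comp_operator L T).
Proof.
move=> /compact_operatorP cL; apply/compact_operatorP => e e0.
pose c := normR T + 1; have c0 : 0 < c by rewrite ltr_wpDl// normR_ge0.
have [|s sL] := cL (e / c); first by rewrite divr_gt0.
exists [seq ofR k c *: y | y <- s] => x x1.
have [|y ys Ly] := sL (ofR k c^-1 *: T x).
  rewrite normRZ_ofR ger0_norm ?invr_ge0 ?(ltW c0)// mulrC ler_pdivrMr// mul1r.
  by rewrite (le_trans (normR_operator_le1 _ x1))// lerDl.
exists (ofR k c *: y); first exact: map_f.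
rewrite (_ : comp_operator L T x = ofR k c *: L (ofR k c^-1 *: T x)); last first.
  by rewrite linearZ /= scalerA -ofRM divff ?gt_eqF// ofR1 scale1r.
by rewrite -scalerBr normRZ_ofR ger0_norm ?(ltW c0)// mulrC -ler_pdivlMr.
Qed.

(** The image of the unit ball under [L] has a finite net, on whose points the [z i] are eventually
    small; the bound [C] controls the distance to the net. *)
Lemma compact_adjoint_cvg0 (X : completeNormedModType K) (L : 'L(X, X))
    (I : Type) (F : set_system I) (FF : Filter F) (z : I -> dual_space X) (C : R) :
  compact_operator L -> (forall i, normR (z i) <= C) ->
  (forall x, (fun i => z i x : K^o) @ F --> (0 : K^o)) ->
  forall e : R, 0 < e -> \forall i \near F, normR (comp_operator (z i) L) <= e.
Proof.
move=> /compact_operatorP cL zC z0 e e0.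
pose c := `|C| + 1; have c0 : 0 < c by rewrite ltr_wpDl.
have [|s sL] := cL (e / 2 / c); first by rewrite !divr_gt0.
have zs : \forall i \near F, forall y, y \in s -> normR (z i y : K^o) < e / 2.
  apply: near_seq => y _; have /cvg_normRP/(_ (e / 2)) := z0 y.
  by rewrite divr_gt0// => /(_ isT); apply: filterS => i; rewrite subr0.
apply: filterS zs => i zs; apply: normR_operator_ub => x x1.
have [y ys Lxy] := sL x x1.
rewrite /= -[L x](subrK y) linearD (le_trans (ler_normRD _ _))//= (splitr e) lerD//.
  rewrite (le_trans (normR_operator_le _ _))//.
  rewrite (@le_trans _ _ (c * normR (L x - y)))//.
    rewrite ler_wpM2r ?normR_ge0// (le_trans (zC i))// (le_trans (ler_norm _))//.
    by rewrite lerDl.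
  by rewrite mulrC -ler_pdivlMr.
exact/ltW/zs.
Qed.

End compact_operators.

(** * The Hahn-Banach theorem *)

Section hahn_banach.
Variables (R : realType) (k : scalar_kind).
Local Notation K := (scalar_field R k).
Variable V : normedModType K.
Implicit Types (p q r : V -> R) (x y : V).

(** Scalars are real, so a complex space is treated as a real one. For t > 0 the second clause
    implies equality, by applying it to 1/t. *)
Definition sublinear p : Prop :=
  (forall x y, p (x + y) <= p x + p y) /\
  (forall t x, 0 <= t -> p (ofR k t *: x) <= t * p x).

Lemma sublinear0 p : sublinear p -> p 0 = 0.
Proof.
move=> [pD pZ]; apply/eqP; rewrite eq_le; apply/andP; split.
  by have := pZ 0 0 (lexx _); rewrite scaler0 mul0r.
by have := pD 0 0; rewrite addr0 lerDl.
Qed.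

Lemma sublinear_ge p x : sublinear p -> - p (- x) <= p x.
Proof.
by move=> sp; rewrite lerNl -subr_ge0 opprK -(sublinear0 sp) -(addNr x) sp.1.
Qed.

(* [q x = inf_(t >= 0) (p (x + t y) - t p y)] *)
Lemma sublinear_le p y : sublinear p ->
  exists q, [/\ sublinear q, forall x, q x <= p x & q (- y) <= - p y].
Proof.
move=> sp; have [pD pZ] := sp.
pose S x := [set p (x + ofR k t *: y) - t * p y | t in [set t : R | 0 <= t]].
have lbS x : lbound (S x) (- p (- x)).
  move=> _ [t /= t0 <-]; rewrite lerBrDr addrC lerBlDr (le_trans _ (pD _ _))//.
  rewrite [_ + ofR k t *: y]addrC addrK.
  have [->|tn0] := eqVneq t 0; first by rewrite ofR0 scale0r (sublinear0 sp) mul0r.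
  have tp : 0 < t by rewrite lt_neqAle eq_sym tn0.
  rewrite mulrC -ler_pdivlMr// mulrC -[leLHS](_ : p (ofR k t^-1 *: (ofR k t *: y)) = _).
    by apply: pZ; rewrite invr_ge0.
  by rewrite scalerA -ofRM mulVf// ofR1 scale1r.
have hS x : has_inf (S x).
  by split; [exists (p (x + ofR k 0 *: y) - 0 * p y), 0 => /=|exists (- p (- x))].
have leS x t : 0 <= t -> inf (S x) <= p (x + ofR k t *: y) - t * p y.
  by move=> t0; apply: ge_inf; [exact: (hS x).2|exists t].
have Sle x u : (forall t, 0 <= t -> u <= p (x + ofR k t *: y) - t * p y) -> u <= inf (S x).
  by move=> uS; apply: lb_le_inf; [exact: (hS x).1|move=> _ [t t0 <-]; exact: uS].
exists (fun x => inf (S x)); split=> [|x|].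
- split=> [x1 x2|t x t0].
    rewrite -lerBlDr; apply: (Sle) => t1 t10; rewrite lerBlDr -lerBlDl.
    apply: (Sle) => t2 t20; rewrite lerBlDl (le_trans (leS _ _ (addr_ge0 t10 t20)))//.
    rewrite mulrDl addrACA -opprD lerD2r ofRD scalerDl addrACA; exact: pD.
  have [->|tn0] := eqVneq t 0.
    by rewrite ofR0 scale0r mul0r (le_trans (leS _ 0 (lexx _)))// ofR0 scale0r addr0
      mul0r subr0 (sublinear0 sp).
  have tp : 0 < t by rewrite lt_neqAle eq_sym tn0.
  rewrite mulrC -ler_pdivrMr//; apply: (Sle) => s s0.
  rewrite ler_pdivrMr// (le_trans (leS _ (t * s) (mulr_ge0 t0 s0)))//.
  by rewrite ofRM -scalerA -scalerDr mulrBl [_ * t]mulrC -mulrA [s * _ * t]mulrC lerD2r pZ.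
- by rewrite (le_trans (leS _ 0 (lexx _)))// ofR0 scale0r addr0 mul0r subr0.
- by rewrite (le_trans (leS _ 1 ler01))// ofR1 scale1r addNr (sublinear0 sp) mul1r sub0r.
Qed.

(** Zorn's lemma for the reversed pointwise order. The infimum of a nonempty chain is finite because
    [- p (- x)] bounds it below, and subadditive because any two members are comparable. *)
Lemma minimal_sublinear p : sublinear p ->
  exists q, [/\ sublinear q, forall x, q x <= p x &
    forall r, sublinear r -> (forall x, r x <= q x) -> r = q].
Proof.
move=> sp; pose T := {q | sublinear q /\ forall x, q x <= p x}.
pose geT (q r : T) := `[< forall x, sval r x <= sval q x >].
have [|||A Atot|[q [sq qp]] qmin] := @Zorn T geT.
- by move=> q; apply/asboolP => x.
- move=> q r s /asboolP qr /asboolP rs; apply/asboolP => x.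
  exact: le_trans (rs x) (qr x).
- move=> [q sq] [r sr] /asboolP qr /asboolP rq; apply: eq_exist; apply/funext => x.
  by apply/eqP; rewrite eq_le qr rq.
- have [->|/set0P[q0 Aq0]] := eqVneq A set0.
    by exists (exist _ p (conj sp (fun x => lexx _))).
  pose S x := [set sval q x | q in A].
  have lbS x : lbound (S x) (- p (- x)).
    move=> _ [q Aq <-]; have [sq qp] := svalP q.
    by rewrite (le_trans _ (sublinear_ge x sq))// lerN2.
  have hS x : has_inf (S x).
    by split; [exists (sval q0 x), q0|exists (- p (- x))].
  have leS x (q : T) : A q -> inf (S x) <= sval q x.
    by move=> Aq; apply: ge_inf; [exact: (hS x).2|exists q].
  have Sle x u : (forall q : T, A q -> u <= sval q x) -> u <= inf (S x).
    by move=> uS; apply: lb_le_inf; [exact: (hS x).1|move=> _ [q Aq <-]; exact: uS].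
  have sS : sublinear (fun x => inf (S x)).
    split=> [x y|t x t0].
      rewrite -lerBlDr; apply: (Sle) => q1 Aq1; rewrite lerBlDr -lerBlDl.
      apply: (Sle) => q2 Aq2; rewrite lerBlDl.
      have [/asboolP q12|/asboolP q21] := Atot _ _ Aq1 Aq2.
        rewrite (le_trans (leS _ _ Aq2))// (le_trans ((svalP q2).1.1 _ _))//.
        by rewrite lerD2r.
      rewrite (le_trans (leS _ _ Aq1))// (le_trans ((svalP q1).1.1 _ _))//.
      by rewrite lerD2l.
    have [->|tn0] := eqVneq t 0.
      rewrite ofR0 scale0r mul0r (le_trans (leS _ _ Aq0))//.
      by rewrite (sublinear0 (svalP q0).1).
    have tp : 0 < t by rewrite lt_neqAle eq_sym tn0.
    rewrite mulrC -ler_pdivrMr//; apply: (Sle) => q Aq.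
    by rewrite ler_pdivrMr// mulrC (le_trans (leS _ _ Aq))// (svalP q).1.2.
  have Sp x : inf (S x) <= p x by rewrite (le_trans (leS _ _ Aq0))// (svalP q0).2.
  exists (exist _ (fun x => inf (S x)) (conj sS Sp)) => q Aq; apply/asboolP => x /=; exact: leS.
exists q; split => // r sr rq.
have rp x : r x <= p x by exact: le_trans (rq x) (qp x).
have := qmin (exist _ r (conj sr rp)).
by move=> /(_ (introT (asboolP _) rq)) [].
Qed.

(** A minimal sublinear [f] is odd: [sublinear_le] at [x] yields a smaller one, equal to [f] by
    minimality, with value at most [- f x] at [- x]. Oddness turns the inequalities into equalities.
    Minimizing below the functional that [sublinear_le] makes from the norm at [x0] forces the value
    at [x0]. *)
Lemma real_norming_functional x0 : exists f : V -> R,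
  [/\ forall x y, f (x + y) = f x + f y, forall t x, f (ofR k t *: x) = t * f x,
      forall x, f x <= normR x & f x0 = normR x0].
Proof.
have sn : sublinear (@normR R k V).
  split=> [x y|t x t0]; first exact: ler_normRD.
  by rewrite normRZ_ofR ger0_norm.
have [p [sp pn px0]] := sublinear_le x0 sn.
have [f [sf fp fmin]] := minimal_sublinear sp.
have fN x : f (- x) = - f x.
  have [q [sq qf qx]] := sublinear_le x sf.
  rewrite (fmin q sq qf) in qx; apply/eqP; rewrite eq_le qx/=.
  by have := sublinear_ge (- x) sf; rewrite opprK.
have fD x y : f (x + y) = f x + f y.
  apply/eqP; rewrite eq_le sf.1/= -lerBrDr -fN.
  by rewrite (le_trans _ (sf.1 _ _))// addrK.
have fZ t x : 0 <= t -> f (ofR k t *: x) = t * f x.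
  move=> t0; apply/eqP; rewrite eq_le sf.2//=.
  have := sf.2 t (- x) t0; rewrite scalerN !fN mulrN lerN2//.
have fn x : f x <= normR x by exact: le_trans (fp x) (pn x).
exists f; split=> // [t x|].
  have [t0|/ltW t0] := leP 0 t; first exact: fZ.
  by rewrite -[t]opprK ofRN scaleNr fN fZ ?oppr_ge0// !mulNr.
apply/eqP; rewrite eq_le fn/= -lerN2 -fN.
exact: le_trans (fp _) px0.
Qed.

End hahn_banach.

Lemma complexification (R : realType) (k : scalar_kind)
    (V : lmodType (scalar_field R k)) (f : V -> R) :
  (forall x y, f (x + y) = f x + f y) ->
  (forall t x, f (ofR k t *: x) = t * f x) ->
  exists g : V -> (scalar_field R k)^o, linear g /\ forall x, re (g x) = f x.
Proof.
case: k V f => V f fD fZ; first by exists f; split => // a x y; rewrite fD fZ.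
have fN x : f (- x) = - f x.
  have -> : - x = ofR ComplexScalars (- 1) *: x by rewrite ofRN ofR1 scaleN1r.
  by rewrite fZ mulN1r.
(* The only complex linear functional with real part [f]: its imaginary part at [x] is minus its
   real part at ['i%C *: x]. *)
pose g x := (f x +i* - f ('i%C *: x))%C.
exists g; split=> // -[c d] x y; rewrite /g.
have -> : (c +i* d)%C = ofR ComplexScalars c + ofR ComplexScalars d * 'i%C.
  by apply/eqP; rewrite eq_complex /=; apply/andP; split; apply/eqP; lra.
rewrite scalerDr scalerA mulrDr.
have -> : 'i%C * ofR ComplexScalars c = ofR ComplexScalars c * 'i%C by rewrite mulrC.
have -> : 'i%C * (ofR ComplexScalars d * 'i%C) = - ofR ComplexScalars d :> R[i].
  by apply/eqP; rewrite eq_complex /=; apply/andP; split; apply/eqP; lra.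
rewrite !scalerDl -!scalerA scaleNr !fD fN !fZ.
by apply/eqP; rewrite eq_complex /=; apply/andP; split; apply/eqP; lra.
Qed.

Lemma norming_functional (R : realType) (k : scalar_kind)
    (V : normedModType (scalar_field R k)) (x0 : V) :
  exists f : dual_space V, normR f <= 1 /\ re (f x0) = normR x0.
Proof.
have [f [fD fZ fn fx0]] := real_norming_functional x0.
have [g [lg gf]] := complexification fD fZ.
have gn x : normR (g x) <= 1 * normR x.
  (* A unimodular factor makes [g x] real and nonnegative, hence a value of [f], so the bound on [f]
     bounds the modulus of [g]. *)
  have [w w1 wg] := rotation (g x).
  rewrite mul1r -[normR (g x)](ofRK k) -wg.
  have g0 : g 0 = 0 by have := lg (- 1) 0 0; rewrite scaler0 addr0 scaleN1r addNr.
  have -> : w * g x = g (w *: x) by rewrite -[w *: x]addr0 lg g0 addr0.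
  by rewrite gf (le_trans (fn _))// normRZ w1 mul1r.
have [G GE] := bounded_operator_exists lg gn.
exists G; split; last by rewrite GE gf.
by apply: normR_operator_ub => x x1; rewrite GE (le_trans (gn x))// mul1r.
Qed.

(** * Property M* *)

Section limsup.
Variable R : realType.
Implicit Types a b : nat -> R.

(** Otherwise [b n + e < a n] for all [n], and the limsup of [a] would exceed that of [b] by at
    least [e]. The bound on [b] makes this limsup finite, hence the contradiction. *)
Lemma limn_esup_shift a b (M e : R) : 0 < e -> (forall n, `|b n| <= M) ->
  limn_esup (fun n => (a n)%:E) = limn_esup (fun n => (b n)%:E) ->
  exists n, a n <= b n + e.
Proof.
move=> e0 bM ab; apply/not_existsP => nab.
have bae n : b n + e < a n by rewrite ltNge; apply/negP/nab.
have ooT : nbhs \oo [set: nat] by exact: filterT.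
have Lfin : limn_esup (fun n => (b n)%:E) \is a fin_num.
  rewrite fin_numE; apply/andP; split.
    rewrite -ltNye (@lt_le_trans _ _ (- M)%:E) ?ltNyr//.
    apply: le_ereal_inf_tmp => _ [V Voo <-].
    have [n Vn] := @filter_ex _ _ _ V Voo.
    apply: (@le_trans _ _ (b n)%:E); last by apply: ereal_sup_ubound; exists n.
    by have := bM n; rewrite ler_norml => /andP[].
  rewrite -ltey (@le_lt_trans _ _ M%:E) ?ltry//.
  apply: (@le_trans _ _ (ereal_sup [set (b n)%:E | n in setT])).
    by apply: ereal_inf_lbound; exists setT.
  apply: ge_ereal_sup => _ [n _ <-].
  by rewrite lee_fin (le_trans (ler_norm _)).
pose l := fine (limn_esup (fun n => (b n)%:E)).
have lE : limn_esup (fun n => (b n)%:E) = l%:E by rewrite fineK.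
have : (limn_esup (fun n => (a n)%:E) < (l + e / 2)%:E)%E.
  by rewrite ab lE lte_fin ltrDl divr_gt0.
move=> /ereal_inf_lt[_ [V Voo <-] Vl].
have : (limn_esup (fun n => (b n)%:E) <= (l - e / 2)%:E)%E.
  apply: (@le_trans _ _ (ereal_sup [set (b n)%:E | n in V])).
    by apply: ereal_inf_lbound; exists V.
  apply: ge_ereal_sup => _ [n Vn <-]; rewrite lee_fin.
  have : ((a n)%:E < (l + e / 2)%:E)%E.
    by apply: le_lt_trans Vl; apply: ereal_sup_ubound; exists n.
  by rewrite lte_fin; have := bae n; lra.
by rewrite lE lee_fin; lra.
Qed.

End limsup.

Lemma separable_sequence (R : realType) (k : scalar_kind)
    (X : normedModType (scalar_field R k)) : separable_space X ->
  exists d : nat -> X, forall x (e : R), 0 < e -> exists n, normR (x - d n) < e.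
Proof.
move=> [D cD dD].
have D0 : D !=set0.
  by have [|x [_ Dx]] := dD setT _ openT; [exists 0|exists x].
have /pfcard_geP[D_0|[d]] := cD.
  by move: D0; rewrite D_0 => -[].
exists d => x e e0.
have ball_e : ball x (ofR k e) = [set y | normR (x - y) < e].
  by apply/seteqP; split=> z; rewrite -ball_normE /= -normRK ltr_ofR.
have [||y [xy Dy]] := dD (ball x (ofR k e)).
- by exists x; rewrite ball_e /= subrr normR0.
- by apply: ball_open; rewrite -(ofR0 R k) ltr_ofR.
have [n _ dn] := 'surj_d Dy.
by exists n; rewrite dn; move: xy; rewrite ball_e.
Qed.

Section property_Mstar.
Variables (R : realType) (k : scalar_kind).
Local Notation K := (scalar_field R k).
Variables (X : normedModType K) (d : nat -> X).
Hypothesis d_dense : forall x (e : R), 0 < e -> exists n, normR (x - d n) < e.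
Hypothesis Mstar : property_Mstar X.
Implicit Types u v w z : dual_space X.

(** A failure for every [n] produces a bounded sequence that tends to 0 at each [d j], hence weak*,
    against M*. In this form M*, stated for sequences, is uniform on a weak* neighbourhood of 0 in a
    ball and so applies along arbitrary filters. The index [n] gives both the number of test points
    and the precision. *)
Lemma Mstar_local u v (C e : R) : normR u = normR v -> 0 < e ->
  exists n, forall z, normR z <= C ->
    (forall j, (j < n)%N -> normR (z (d j)) < n.+1%:R^-1) ->
    normR (u + z) <= normR (v + z) + e.
Proof.
move=> uv e0; apply/not_existsP => H.
have /choice[z zP] : forall n, exists z, [/\ normR z <= C,
    forall j, (j < n)%N -> normR (z (d j)) < n.+1%:R^-1 &
    normR (v + z) + e < normR (u + z)].
  move=> n; have /existsNP[z /not_implyP[zC /not_implyP[zd /negP]]] := H n.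
  by rewrite -ltNge => zuv; exists z.
have z0 : weak_star_cvg0 z.
  move=> x; apply/cvg_normRP => s s0.
  pose c := `|C| + 1; have c0 : 0 < c by rewrite ltr_wpDl.
  have sc : 0 < s / 2 / c by rewrite !divr_gt0.
  have [j xj] := d_dense x sc.
  have s2 : 0 < s / 2 by rewrite divr_gt0.
  near=> n; rewrite subr0 -[x](subrK (d j)) linearD.
  rewrite (le_lt_trans (ler_normRD _ _))// (splitr s) ltr_leD//.
    rewrite (le_lt_trans (normR_operator_le _ _))//.
    rewrite (@le_lt_trans _ _ (c * normR (x - d j)))//.
      rewrite ler_wpM2r ?normR_ge0//; have [zC _ _] := zP n.
      by rewrite (le_trans zC)// (le_trans (ler_norm _))// lerDl.
    by rewrite mulrC -ltr_pdivlMr.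
  have [_ zd _] := zP n; apply: (le_trans (ltW (zd j _))).
    by near: n; exact: nbhs_infty_gt.
  by apply/ltW; near: n; exact: near_infty_natSinv_lt (PosNum s2).
have uvK : `|u| = `|v| by rewrite -!normRK uv.
have [] := @limn_esup_shift R _ _ (normR v + C) e e0 _ (Mstar uvK z0).
  move=> n; rewrite ger0_norm ?normR_ge0// (le_trans (ler_normRD _ _))// lerD2l.
  by have [] := zP n.
by move=> n; have [_ _] := zP n; rewrite leNgt => ->.
Unshelve. all: by end_near. Qed.

Section filter.
Context (I : Type) (F : set_system I) {FF : Filter F}.
Variables (z : I -> dual_space X) (C : R).
Hypothesis zC : forall i, normR (z i) <= C.
Hypothesis z0 : forall x, (fun i => z i x : K^o) @ F --> (0 : K^o).

Lemma Mstar_near_eq u v (e : R) : normR u = normR v -> 0 < e ->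
  \forall i \near F, normR (u + z i) <= normR (v + z i) + e.
Proof.
move=> uv e0; have [n nP] := Mstar_local C uv e0.
have : \forall i \near F, forall j, j \in iota 0 n ->
    normR (z i (d j) : K^o) < n.+1%:R^-1.
  apply: near_seq => j _; have /cvg_normRP/(_ n.+1%:R^-1) := z0 (d j).
  by rewrite invr_gt0 ltr0Sn => /(_ isT); apply: filterS => i; rewrite subr0.
by apply: filterS => i zi; apply: nP => // j jn; apply: zi; rewrite mem_iota.
Qed.

(** Write u = s u' with u' of the same norm as [v] and s in [0, 1], apply the case of equal norms to
    u' and - u', and interpolate by [normR_segment]. *)
Lemma Mstar_near u v (e : R) : normR u <= normR v -> 0 < e ->
  \forall i \near F, normR (u + z i) <= normR (v + z i) + e.
Proof.
move=> uv e0.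
have [u' [s [s01 -> u'v]]] : exists u' (s : R),
    [/\ 0 <= s <= 1, u = ofR k s *: u' & normR u' = normR v].
  have [->|u_neq0] := eqVneq u 0.
    by exists v, 0; rewrite lexx ler01 ofR0 scale0r.
  have nu0 : 0 < normR u by rewrite normR_gt0.
  have nv0 : 0 < normR v by exact: lt_le_trans uv.
  exists (ofR k (normR v / normR u) *: u), (normR u / normR v); split.
  - by rewrite divr_ge0 ?normR_ge0// ler_pdivrMr// mul1r.
  - by rewrite scalerA -ofRM mulrA divfK ?gt_eqF// divff ?gt_eqF// ofR1 scale1r.
  - by rewrite normRZ_ofR ger0_norm ?divr_ge0 ?normR_ge0// divfK// gt_eqF.
have Nu'v : normR (- u') = normR v by rewrite normRN.
apply: filterS (filterI (Mstar_near_eq u'v e0) (Mstar_near_eq Nu'v e0)) => i [uz Nuz].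
exact: normR_segment.
Qed.

End filter.

(* Since |T| = 1, there is a functional w with |w| <= |u| and |w T| close to |u|;
   M* is used to compare u S with w T and then w with u. *)
Lemma Mstar_operator_near (I : Type) (F : set_system I) (FF : Filter F)
    (z : I -> dual_space X) (C : R) (S T : 'L(X, X)) u (e : R) :
  (forall i, normR (z i) <= C) ->
  (forall x, (fun i => z i x : K^o) @ F --> (0 : K^o)) ->
  normR S <= 1 -> normR T = 1 -> 0 < e ->
  \forall i \near F,
    normR (comp_operator u S + comp_operator (z i) T) <= normR (u + z i) + e.
Proof.
move=> zC z0 S1 T1 e0; pose r := normR u.
have r0 : 0 <= r by exact: normR_ge0.
have e2 : 0 < e / 2 by rewrite divr_gt0.
have e4 : 0 < e / 2 / 2 by rewrite divr_gt0.
(* The precision [h] in norming [T] is such that h r is at most e/2; [r + 1] in place of [r] allows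
   r = 0. *)
have h0 : 0 < e / 2 / (r + 1) by rewrite divr_gt0// ltr_wpDl.
have hr : e / 2 / (r + 1) * r <= e / 2.
  by rewrite mulrAC ler_pdivrMr ?ltr_wpDl// ler_pM2l// lerDl.
have [x x1] := normR_operator_approx T h0; rewrite T1.
set h := e / 2 / (r + 1) in h0 hr * => hTx.
have [f [f1 fTx]] := norming_functional (T x).
pose w : dual_space X := ofR k r *: f.
have wr : normR w <= normR u.
  by rewrite normRZ_ofR ger0_norm// ler_piMr.
(* Truncating at 0 keeps [s] nonnegative when [h] exceeds 1. *)
pose s := Num.max 0 (1 - h).
have s0 : 0 <= s by rewrite le_max lexx.
have sTx : s <= normR (T x) by rewrite ge_max normR_ge0 ltW.
have Tw : r * s <= normR (comp_operator w T).
  rewrite (le_trans _ (normR_operator_le1 _ x1))// (le_trans _ (ler_re_normR _))//.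
  by rewrite /w /= re_ofRM fTx ler_wpM2l.
have Su : normR (ofR k s *: comp_operator u S : dual_space X) <= normR (comp_operator w T).
  rewrite (le_trans _ Tw)// normRZ_ofR ger0_norm// mulrC ler_wpM2r//.
  by rewrite (le_trans (normR_comp_operator _ _))// ler_piMr// normR_ge0.
have TzC i : normR (comp_operator (z i) T : dual_space X) <= C.
  by rewrite (le_trans (normR_comp_operator _ _))// T1 mulr1.
have Tz0 y : (fun i => comp_operator (z i) T y : K^o) @ F --> (0 : K^o) by exact: z0.
apply: filterS (filterI (Mstar_near zC z0 wr e4) (Mstar_near TzC Tz0 Su e4)) => i [wz uz].
(* Only s u S is known to have norm at most that of w T, so (1 - s) u S is split off; it costs at
   most h r. *)
have -> : comp_operator u S + comp_operator (z i) T = ofR k (1 - s) *: comp_operator u S +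
    (ofR k s *: comp_operator u S + comp_operator (z i) T) :> dual_space X.
  by rewrite addrA -scalerDl -ofRD subrK ofR1 scale1r.
rewrite (le_trans (ler_normRD _ _))//.
have s1 : 0 <= 1 - s <= h.
  by rewrite subr_ge0 ge_max ler01/= gerBl ltW//= lerBlDl -lerBlDr le_max lexx orbT.
have Sur : normR (ofR k (1 - s) *: comp_operator u S : dual_space X) <= e / 2.
  rewrite normRZ_ofR (le_trans _ hr)// ger0_norm; last by case/andP: s1.
  rewrite ler_pM ?normR_ge0//; [by case/andP: s1|by case/andP: s1|].
  by rewrite (le_trans (normR_comp_operator _ _))// ler_piMr// normR_ge0.
have wTz : normR (comp_operator w T + comp_operator (z i) T : dual_space X) <= normR (w + z i).
  have -> : comp_operator w T + comp_operator (z i) T = comp_operator (w + z i) T.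
    exact: operator_eqP.
  by rewrite (le_trans (normR_comp_operator _ _))// T1 mulr1.
rewrite (le_trans (lerD Sur (le_trans uz (lerD (le_trans wTz wz) (lexx (e / 2 / 2))))))//.
by rewrite -addrA -splitr addrCA -splitr.
Qed.

(** If q (z n) > e for all n, adding suitable [z n] one at a time yields sums of N terms with norm
    at most r + h on which [q] is at least N e; for large N this contradicts the bound on [q].
    Additivity is the right generality, as [q] will be the real part of a functional. *)
Lemma Mstar_additive_bound (z : nat -> dual_space X) u (q : dual_space X -> R) (C e : R) :
  (forall n, normR (u + z n) <= normR u) -> weak_star_cvg0 z ->
  (forall v w, q (v + w) = q v + q w) -> (forall w, `|q w| <= C * normR w) ->
  0 < e -> exists n, q (z n) <= e.
Proof.
move=> uz z0 qD qC e0; apply/not_existsP => qz.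
pose r := normR u; have r0 : 0 <= r by exact: normR_ge0.
have zr n : normR (z n) <= r + r.
  by rewrite -[z n](addKr u) (le_trans (ler_normRD _ _))// normRN lerD2l.
have q0 : q 0 = 0 by apply: (addrI (q 0)); rewrite -qD !addr0.
have sum N : forall h, 0 < h -> exists2 w, normR w <= r + h & N%:R * e <= q w.
  elim: N => [|N IH] h h0.
    by exists 0; rewrite ?q0 ?mul0r// normR0 addr_ge0// ltW.
  have h2 : 0 < h / 2 by rewrite divr_gt0.
  have rh : 0 < r + h / 2 by rewrite ltr_wpDl.
  have [w wr qw] := IH _ h2.
  (* Rescaling [w] to norm at most that of [u] costs h/2 and lets M* compare [w1 + z n] with
     [u + z n]. *)
  pose w1 : dual_space X := ofR k (r / (r + h / 2)) *: w.
  have w1u : normR w1 <= normR u.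
    rewrite normRZ_ofR ger0_norm ?divr_ge0 ?(ltW rh)//.
    by rewrite mulrAC ler_pdivrMr// ler_wpM2l.
  have ww1 : normR (w - w1) <= h / 2.
    rewrite -[w in w - _]scale1r -scalerBl -(ofR1 R k) -ofRN -ofRD normRZ_ofR.
    have -> : 1 - r / (r + h / 2) = h / 2 / (r + h / 2).
      apply: (mulIf (lt0r_neq0 rh)).
      by rewrite mulrBl mul1r !divfK ?lt0r_neq0// addrAC subrr add0r.
    rewrite ger0_norm ?divr_ge0 ?(ltW h0) ?(ltW rh)//.
    by rewrite mulrAC ler_pdivrMr// ler_pM2l.
  have [n wzn] : exists n, normR (w1 + z n) <= normR (u + z n) + h / 2.
    exact: filter_ex (Mstar_near (F := \oo) zr z0 w1u h2).
  exists (w + z n : dual_space X).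
    rewrite -[w](subrK w1) -addrA (le_trans (ler_normRD _ _))//.
    rewrite (le_trans (lerD ww1 wzn))// addrCA -splitr lerD2r; exact: uz.
  rewrite qD -natr1 mulrDl mul1r lerD//.
  by rewrite leNgt; apply/negP => /ltW; exact: qz.
pose N := (Num.truncn (`|C| * (r + 1) / e)).+1.
have [w wr qw] := sum N 1 ltr01.
have : N%:R * e <= `|C| * (r + 1).
  rewrite (le_trans qw)// (le_trans (ler_norm _))// (le_trans (qC _))//.
  by rewrite (le_trans (ler_wpM2r (normR_ge0 w) (ler_norm C)))// ler_wpM2l.
by rewrite -ler_pdivlMr// leNgt truncnS_gt.
Qed.

End property_Mstar.

(** * Simons' inequality *)

Section half.
Variables (R : realType) (k : scalar_kind).
Local Notation K := (scalar_field R k).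

Definition midpoint (E : lmodType K) (x y : E) : E := ofR k 2^-1 *: (x + y).

Lemma midpointE (E E' : lmodType K) (h : E -> E') x y :
  linear h -> h (midpoint x y) = midpoint (h x) (h y).
Proof.
move=> lh; have h0 : h 0 = 0.
  by have := lh (- 1) 0 0; rewrite scaler0 addr0 scaleN1r addNr.
have hD a b : h (a + b) = h a + h b by rewrite -[a]scale1r lh !scale1r.
by rewrite /midpoint -[_ *: (x + y)]addr0 lh h0 addr0 hD.
Qed.

Lemma midpointB (E : lmodType K) (x y z : E) :
  midpoint x y - midpoint x z = ofR k 2^-1 *: (y - z).
Proof. by rewrite /midpoint -scalerBr opprD addrACA subrr add0r. Qed.

Lemma normR_midpoint (E : normedModType K) (x y : E) (M : R) :
  normR x <= M -> normR y <= M -> normR (midpoint x y) <= M.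
Proof.
move=> xM yM; rewrite normRZ_ofR ger0_norm ?invr_ge0// mulrC ler_pdivrMr//.
by rewrite (le_trans (ler_normRD _ _))// mulr_natr mulr2n lerD.
Qed.

Lemma midpointD (E : lmodType K) (x y : E) : midpoint x y + midpoint x y = x + y.
Proof.
rewrite /midpoint -scalerDl -ofRD.
have -> : 2^-1 + 2^-1 = 1 :> R by rewrite [RHS]splitr mul1r.
by rewrite ofR1 scale1r.
Qed.

Lemma midpoint_diag (E : lmodType K) (x : E) : midpoint x x = x.
Proof.
by have := midpointD x 0; rewrite /midpoint !addr0 scalerDr.
Qed.

(** Half sums suffice because all weights in the series below come from iterated halving. *)
Definition midconvex (E : lmodType K) (A : set E) : Prop :=
  forall x y, A x -> A y -> A (midpoint x y).

Lemma closed_normR (E : normedModType K) (A : set E) :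
  (forall x, (forall e : R, 0 < e -> exists2 y, A y & normR (x - y) < e) -> A x) ->
  closed A.
Proof.
move=> Acl x xA; apply: Acl => e e0.
have [|y [Ay xy]] := xA (ball x (ofR k e)).
  by apply: nbhsx_ballx; rewrite -(ofR0 R k) ltr_ofR.
by exists y => //; move: xy; rewrite -ball_normE /= -normRK ltr_ofR.
Qed.

Section linear_preimage.
Variables (E E' : normedModType K) (h : E -> E') (M : R).
Hypotheses (lh : linear h) (hM : forall x, normR (h x) <= M * normR x).

Lemma closed_linear_preimage (c : E') (r : R) :
  closed [set x | normR (h x - c) <= r].
Proof.
apply: closed_normR => x xA /=; apply/ler_addgt0Pr => e e0.
pose m := `|M| + 1; have m0 : 0 < m by rewrite ltr_wpDl.
have [|y /= hy xy] := xA (e / m); first by rewrite divr_gt0.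
rewrite (le_trans (ler_distRD (h y) _ _))// addrC lerD//.
have -> : h x - h y = h (x - y).
  by rewrite (addrC x) -[- y]scaleN1r lh scaleN1r addrC.
rewrite (le_trans (hM _))// (@le_trans _ _ (m * normR (x - y)))//.
  by rewrite ler_wpM2r ?normR_ge0// (le_trans (ler_norm _))// lerDl.
by rewrite mulrC -ler_pdivlMr// ltW.
Qed.

Lemma midconvex_linear_preimage (c : E') (r : R) :
  midconvex [set x | normR (h x - c) <= r].
Proof.
move=> x y /= xr yr; rewrite midpointE// -[c]midpoint_diag.
rewrite /midpoint -scalerBr opprD addrACA; exact: normR_midpoint.
Qed.

End linear_preimage.

(* Simons' inequality, with the maximum points of the functions replaced by
   near maximum points: [Lam n] is the n-th tail of the series
   [sum_k 2^-(k+1) g_k], where g_k almost minimizes over [D k] the norm of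
   [V k + A g] with [V k = sum_(j < k) 2^(k-j-1) A g_j]. *)
Lemma simons (U : normedModType K) (V : completeNormedModType K)
    (E : normedModType K) (A : 'L(U, V) -> E) (D : nat -> set 'L(U, V)) (e : R) :
  0 < e -> (forall L L', A (midpoint L L') = midpoint (A L) (A L')) ->
  (forall n, D n !=set0) -> (forall n, D n.+1 `<=` D n) ->
  (forall n, closed (D n)) -> (forall n, midconvex (D n)) ->
  (forall n L, D n L -> normR L <= 1) ->
  exists Lam : nat -> 'L(U, V), (forall n, D n (Lam n)) /\ forall n,
    normR (ofR k (2 ^+ n) *: A (Lam 0%N) - A (Lam n)) <=
      (2 ^+ n - 1) * normR (A (Lam 0%N)) + e.
Proof.
move=> e0 Amid D0 Dsub Dcl Dmid D1.
pose eps n : R := e / 2 ^+ n.+1.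
have eps0 n : 0 < eps n by rewrite divr_gt0// exprn_gt0.
(* The choice is made for every pair of an index and a vector, since [v n] will depend on the
   earlier choices. *)
have /choice[pick pickP] : forall nv : nat * E, exists g, D nv.1 g /\
    forall L, D nv.1 L -> normR (nv.2 + A g) <= normR (nv.2 + A L) + eps nv.1.
  move=> [n v] /=; pose N := [set normR (v + A L) | L in D n].
  have hN : has_inf N.
    have [L DL] := D0 n; split; first by exists (normR (v + A L)), L.
    by exists 0 => _ [L' _ <-]; exact: normR_ge0.
  have [_ [g Dg <-] gN] := inf_adherent (eps0 n) hN.
  exists g; split => // L DL; rewrite (le_trans (ltW gN))// lerD2r.
  by apply: ge_inf; [exact: hN.2|exists L].
pose v := fix v n := if n is m.+1 then v m + (v m + A (pick (m, v m))) else 0.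
pose g n := pick (n, v n).
have Dg n : D n (g n) by have [] := pickP (n, v n).
(* [P m n] is 2^-1 g_n + ... + 2^-m g_(n+m-1) + 2^-m g_(n+m): the last weight is doubled so that the
   weights add up to 1 and the sum lies in [D n]. *)
pose P := fix P m n := if m is m'.+1 then midpoint (g n) (P m' n.+1) else g n.
have DP m : forall n, D n (P m n).
  by elim: m => [|m IH] n //=; apply: Dmid => //; exact: Dsub (IH _).
(* After [m] common halvings only the remainders differ, and each has norm at most 1. *)
have P_cauchy m : forall m' n, (m <= m')%N -> normR (P m' n - P m n) <= 2 / 2 ^+ m.
  elim: m => [|m IH] m' n mm'.
    rewrite expr0 divr1 (le_trans (ler_normRB _ _))//.
    by rewrite -[2]/(1 + 1) lerD//; apply: D1; exact: DP.
  case: m' mm' => // m' mm'; rewrite /= midpointB normRZ_ofR ger0_norm ?invr_ge0//.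
  by rewrite exprS invfM mulrCA ler_wpM2l ?invr_ge0// IH.
have P_cvg n : exists l : 'L(U, V), P ^~ n @ \oo --> l.
  apply: operator_cvg => s s0.
  have [N sN] : exists N, 2 / s <= 2 ^+ N :> R.
    exists (Num.truncn (2 / s)).+1; apply: (le_trans (ltW (truncnS_gt _))).
    by rewrite -natrX ler_nat ltnW// ltn_expl.
  exists N => m Nm; rewrite (le_trans (P_cauchy _ _ _ Nm))//.
  by rewrite ler_pdivrMr ?exprn_gt0// mulrC -ler_pdivrMr.
have /choice[Lam LamP] := P_cvg.
have LamD n : D n (Lam n).
  by apply: (closed_cvg (D n) (Dcl n) _ _ (LamP n)); apply: nearW => m; exact: DP.
have LamE n : Lam n = midpoint (g n) (Lam n.+1).
  have shiftP : [sequence P m.+1 n]_m @ \oo --> Lam n.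
    by rewrite (cvg_shiftS (P ^~ n)); exact: LamP.
  apply: (@cvg_unique _ (@norm_hausdorff _ _) _ _ _ _ shiftP).
  apply: cvgZl_tmp; apply: cvgD; first exact: cvg_cst.
  exact: LamP.
exists Lam; split=> // n.
set u := A (Lam 0%N); pose t m : R := 2 ^+ m.
have vE m : ofR k (t m) *: u = v m + A (Lam m).
  elim: m => [|m IH]; first by rewrite /t expr0 ofR1 scale1r add0r.
  have -> : t m.+1 = t m + t m by rewrite /t exprS mulr_natl mulr2n.
  rewrite ofRD scalerDl IH /= -/(g m) LamE Amid.
  set a := A (g m); set b := A (Lam m.+1).
  have -> : v m + midpoint a b + (v m + midpoint a b) =
      v m + v m + (midpoint a b + midpoint a b) by rewrite addrACA.
  by rewrite midpointD !addrA.
(* [g m] almost minimizes over [D m], which contains [Lam m], so [vE] bounds the norm of v_m + A g_m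
   by 2^m |u| + eps_m. The term [e * (1 - (t m)^-1)] is the sum of the eps_j for j < m. *)
have vn m : normR (v m) <= (t m - 1) * normR u + e * (1 - (t m)^-1).
  elim: m => [|m IH]; first by rewrite /t expr0 invr1 !subrr mul0r mulr0 addr0 normR0.
  have [_ /(_ _ (LamD m)) /=] := pickP (m, v m); rewrite -vE normRZ_ofR.
  rewrite (ger0_norm (exprn_ge0 _ _))//.
  rewrite /= => vm; rewrite (le_trans (ler_normRD _ _))//.
  rewrite (le_trans (lerD IH vm))// /eps -/(t m.+1) -/(t m).
  have tm : 0 < t m by rewrite exprn_gt0.
  have -> : t m.+1 = 2 * t m by rewrite /t exprS.
  rewrite addrACA; have -> : (t m)^-1 = 2 * (2 * t m)^-1.
    by rewrite invfM mulrA divff// mul1r.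
  by move: (normR u) (2 * t m)^-1 => a b; nra.
rewrite -/(t n) vE addrK (le_trans (vn n))// lerD2l ler_piMr ?(ltW e0)//.
by rewrite gerBl invr_ge0 exprn_ge0.
Qed.

End half.

(** * Compact approximations of the identity *)

Lemma split3 (R : realType) (e : R) : e = e / 3 + (e / 3 + e / 3).
Proof. by lra. Qed.

Lemma split4 (R : realType) (e : R) : e = e / 4 + (e / 4 + (e / 4 + e / 4)).
Proof. by lra. Qed.

(** The last two inequalities give t (b - h) <= t c <= a + (t - 1) b + e/2; subtract (t - 1) b. In
    use, [b] is the norm of [A (Lam 0%N)], [h] the defect of a near maximum point and [t] the power
    2^n from [simons]. *)
Lemma near_maximum_bound (R : realType) (t a b c h e : R) :
  0 < t -> a <= 1 + e / 2 / 2 -> h * t <= e / 2 / 2 -> b - h <= c ->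
  t * c - a <= (t - 1) * b + e / 2 -> b <= 1 + e.
Proof.
by move=> t0 ae ht bc tc; have := ler_wpM2l (ltW t0) bc; lra.
Qed.

(** Weak* compactness of dual balls, as pointwise limits along an ultrafilter. The [f i] are plain
    functions so that evaluations at points are covered too; their limits lie in the bidual. *)
Lemma ultra_dual (R : realType) (k : scalar_kind)
    (X : normedModType (scalar_field R k)) (I : Type) (U : set_system I)
    (f : I -> X -> (scalar_field R k)^o) (C : R) :
  UltraFilter U -> (forall i, linear (f i)) ->
  (forall i x, normR (f i x) <= C * normR x) ->
  exists F : dual_space X, (forall x, normR (F x : (scalar_field R k)^o) <= C * normR x) /\
    forall x, (fun i => f i x) @ U --> (F x : (scalar_field R k)^o).
Proof.
move=> UU lf fC; have FU := @ultra_proper _ _ UU.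
have /choice[G GP] : forall x, exists l : (scalar_field R k)^o,
    (fun i => f i x) @ U --> l.
  by move=> x; apply: ultra_cvg => i; exact: fC.
have lG : linear G.
  move=> a x y; apply: (@cvg_unique _ (@norm_hausdorff _ _) _ _ _ _ (GP _)).
  rewrite (_ : (fun i => f i (a *: x + y)) = (fun i => a *: f i x + f i y)).
    by apply: cvgD => //; apply: cvgZl_tmp.
  by apply/funext => i; exact: lf.
have GC x : normR (G x) <= C * normR x.
  apply/ler_addgt0Pr => e e0; have /cvg_normRP/(_ e e0) := GP x.
  move=> /(@filter_ex _ _ FU)[i /ltW]; rewrite distRC => fG.
  by rewrite -[G x](subrK (f i x)) (le_trans (ler_normRD _ _))// addrC lerD.
have [F FE] := bounded_operator_exists lG GC.
by exists F; split=> x; rewrite FE.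
Qed.

Section approximants.
Variables (R : realType) (k : scalar_kind).
Local Notation K := (scalar_field R k).
Variables (X : completeNormedModType K) (d : nat -> X).
Hypothesis d_dense : forall x (e : R), 0 < e -> exists n, normR (x - d n) < e.
Implicit Types L S T : 'L(X, X).

(** [n] is both the number of test points and the precision, so these sets decrease; since [d] is
    dense, they encode strong convergence to the identity without a net. *)
Definition approximant (n : nat) : set 'L(X, X) :=
  [set L | [/\ compact_operator L, normR L <= 1 &
    forall j, (j < n)%N -> normR (L (d j) - d j) <= n.+1%:R^-1]].

Lemma approximant_le m n L : (m <= n)%N -> approximant n L -> approximant m L.
Proof.
move=> mn [cL L1 Ld]; split=> // j jm.
rewrite (le_trans (Ld j (leq_trans jm mn)))//.
by rewrite lef_pV2 ?posrE ?ltr0Sn// ler_nat.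
Qed.

Lemma approximant_exists n : metric_compact_approximation_property X ->
  approximant n !=set0.
Proof.
move=> [I [le [T [[[i0] le_refl le_trans' le_dir] cT T1 Tcvg]]]].
have tF : ProperFilter (tails le).
  apply: filter_from_proper; last by move=> i _; exists i; exact: le_refl.
  apply: filter_from_filter; first by exists i0.
  move=> i j _ _; have [l [il jl]] := le_dir i j.
  by exists l => // m /= lm; split; apply: le_trans' lm.
have : \forall i \near tails le, forall j, j \in iota 0 n ->
    normR (T i (d j) - d j) < n.+1%:R^-1.
  apply: near_seq => j _; have /cvg_normRP := Tcvg (d j); apply.
  by rewrite invr_gt0 ltr0Sn.
move=> /(@filter_ex _ _ tF)[i Ti]; exists (T i); split => [||j jn].
- exact: cT.
- by rewrite -normR_le1.
- by apply/ltW/Ti; rewrite mem_iota.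
Qed.

Lemma approximant_cvg x (e : R) : 0 < e ->
  exists n, forall L, approximant n L -> normR (L x - x) <= e.
Proof.
move=> e0; have e3 : 0 < e / 3 by rewrite divr_gt0.
have [j xj] := d_dense x e3.
have [m me] : exists m, m.+1%:R^-1 <= e / 3.
  by have [N _ NP] := near_infty_natSinv_lt (PosNum e3); exists N; apply/ltW/NP => /=.
exists (maxn m j.+1) => L [_ L1 Ld].
rewrite [leRHS]split3.
rewrite (le_trans (ler_distRD (L (d j)) _ _))// lerD//.
  rewrite -linearB (le_trans (normR_operator_le _ _))//.
  by rewrite (le_trans _ (ltW xj))// ler_piMl// normR_ge0.
rewrite (le_trans (ler_distRD (d j) _ _))// lerD//; last by rewrite distRC ltW.
rewrite (le_trans (Ld j _)) ?leq_maxr// (le_trans _ me)//.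
by rewrite lef_pV2 ?posrE ?ltr0Sn// ler_nat ltnS leq_maxl.
Qed.

(** Strong convergence of operators of norm at most 1 is uniform on totally bounded sets, here the
    image of the unit ball under [T]. *)
Lemma approximant_compact T (e : R) : compact_operator T -> 0 < e ->
  exists n, forall L, approximant n L -> normR (comp_operator L T - T) <= e.
Proof.
move=> /compact_operatorP cT e0; have e3 : 0 < e / 3 by rewrite divr_gt0.
have [s sT] := cT _ e3.
have [n nP] : exists n, forall L, approximant n L ->
    forall y, y \in s -> normR (L y - y) <= e / 3.
  elim: {sT} s => [|y s [n1 n1P]]; first by exists 0%N.
  have [n2 n2P] := approximant_cvg y e3.
  exists (maxn n1 n2) => L aL z; rewrite inE => /predU1P[->|zs].
    by apply: n2P; apply: approximant_le aL; exact: leq_maxr.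
  by apply: (n1P L) => //; apply: approximant_le aL; exact: leq_maxl.
exists n => L aL; have [_ L1 _] := aL.
apply: normR_operator_ub => x x1; have [y ys Txy] := sT x x1.
rewrite [leRHS]split3.
rewrite operatorB (le_trans (ler_distRD (L y) _ _))// lerD//.
  rewrite /= -linearB (le_trans (normR_operator_le _ _))//.
  by rewrite (le_trans _ Txy)// ler_piMl// normR_ge0.
rewrite (le_trans (ler_distRD y _ _))// lerD//; last by rewrite distRC.
exact: nP.
Qed.

Lemma linear_eval x : linear (fun L => L x).
Proof. by []. Qed.

Lemma closed_approximant n : closed (approximant n).
Proof.
rewrite (_ : approximant n = compact_operators X `&` ([set L : 'L(X, X) | normR (L - 0) <= 1] `&`
    \bigcap_(j in [set j | (j < n)%N]) [set L : 'L(X, X) | normR (L (d j) - d j) <= n.+1%:R^-1])).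
  apply: closedI; first exact: closed_compact_operators.
  apply: closedI.
    apply: (@closed_linear_preimage R k _ _ id 1) => // L; by rewrite mul1r.
  apply: closed_bigI => j _.
  apply: (@closed_linear_preimage R k _ _ _ (normR (d j)) (linear_eval (d j))) => L.
  by rewrite mulrC normR_operator_le.
by apply/seteqP; split=> L /=; rewrite subr0; [move=> []|move=> [? []]].
Qed.

Lemma midconvex_approximant n : midconvex (approximant n).
Proof.
move=> L L' [cL L1 Ld] [cL' L'1 L'd]; split=> [||j jn].
- have [c0 clin] := compact_operator_linear_subspace X.
  rewrite /midpoint scalerDr; apply: (clin) => //.
  by rewrite -[_ *: L']addr0; exact: clin.
- exact: normR_midpoint.
- have := @midconvex_linear_preimage R k _ _ _ (linear_eval (d j)) (d j) n.+1%:R^-1.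
  by apply; [exact: Ld|exact: L'd].
Qed.

Hypothesis Mstar : property_Mstar X.

(** Along [U] the [f i] tend weak* to some [F] and the [x i] to some [Q] in the bidual. With y_i =
    f_i - F and z_n = F Lam_n - F the expression is (F S + y_i T) x_i + y_i Lam_n (S - T) x_i + z_n
    (S - T) x_i. The first term is controlled by M*, the second by compactness of Lam_n, the third
    by the choice of [n], which depends on [Q] but not on [i]. *)
Lemma approximant_combination_eventually (I : Type) (U : set_system I) (S T : 'L(X, X))
    (Lam : nat -> 'L(X, X)) (x : I -> X) (f : I -> dual_space X) (e : R) :
  UltraFilter U -> 0 < e -> normR S <= 1 -> normR T = 1 ->
  (forall n, approximant n (Lam n)) ->
  (forall i, normR (x i) <= 1) -> (forall i, normR (f i) <= 1) ->
  exists n, \forall i \near U,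
    re (f i (T (x i)) + f i (Lam n ((S - T) (x i)))) <= 1 + e.
Proof.
move=> UU e0 S1 T1 Lamn x1 f1; have FU := @ultra_proper _ _ UU.
have [F [FC fF]] : exists F : dual_space X, (forall y, normR (F y : K^o) <= 1 * normR y) /\
    forall y, (fun i => f i y : K^o) @ U --> (F y : K^o).
  apply: ultra_dual => [i|i y]; first exact: operator_linear.
  by rewrite (le_trans (normR_operator_le _ _))// ler_wpM2r ?normR_ge0.
have F1 : normR F <= 1.
  by apply: normR_operator_ub => y y1; rewrite (le_trans (FC y))// mul1r.
have [Q [QC xQ]] : exists Q : dual_space (dual_space X),
    (forall w, normR (Q w : K^o) <= 1 * normR w) /\
    forall w, (fun i => (w : dual_space X) (x i) : K^o) @ U --> (Q w : K^o).
  apply: (@ultra_dual R k (dual_space X) I U (fun i w => w (x i))) => [i|i w].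
    by move=> a v w.
  by rewrite mul1r normR_operator_le1.
pose z n : dual_space X := comp_operator F (Lam n) - F.
have ST2 : normR (S - T) <= 2.
  by rewrite (le_trans (ler_normRB _ _))// T1 -[2]/(1 + 1) lerD2r.
pose q (w : dual_space X) := re (Q (comp_operator w (S - T))).
have e4 : 0 < e / 4 by rewrite divr_gt0.
have [n qn] : exists n, q (z n) <= e / 4.
  apply: (@Mstar_additive_bound R k X d d_dense Mstar z F q 2) => //.
  - move=> n; rewrite /z addrC subrK (le_trans (normR_comp_operator _ _))//.
    by rewrite ler_piMr ?normR_ge0//; have [] := Lamn n.
  - move=> y; apply/cvg_normRP => s s0; have s2 : 0 < s / 2 by rewrite divr_gt0.
    have [N NP] := approximant_cvg y s2; exists N => // n /= Nn.
    change (normR (F (Lam n y) - F y - 0 : K^o) < s).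
    rewrite subr0 -linearB (le_lt_trans (FC _))// mul1r.
    rewrite (le_lt_trans (NP _ (approximant_le Nn (Lamn n))))//.
    by rewrite ltr_pdivrMr// mulr_natr mulr2n ltrDl.
  - by move=> v w; rewrite /q -reD -linearD; congr (re (Q _)); exact: operator_eqP.
  - move=> w; rewrite (le_trans (ler_norm_re _))// (le_trans (QC _))// mul1r.
    by rewrite (le_trans (normR_comp_operator _ _))// mulrC ler_wpM2r ?normR_ge0.
exists n.
pose y i : dual_space X := f i - F.
have y2 i : normR (y i) <= 2.
  by rewrite (le_trans (ler_normRB _ _))// -[2]/(1 + 1) lerD.
have y0 v : (fun i => y i v : K^o) @ U --> (0 : K^o).
  apply/cvg_normRP => s s0; have /cvg_normRP/(_ s s0) := fF v.
  by apply: filterS => i; rewrite subr0.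
(* The extra factor 1/2 compensates for the norm of [S - T], at most 2. *)
have e8 : 0 < e / 4 / 2 by rewrite divr_gt0.
have [cLam _ _] := Lamn n.
have near1 := Mstar_operator_near d_dense Mstar FU F y2 y0 S1 T1 e4.
have near2 := compact_adjoint_cvg0 FU cLam y2 y0 e8.
have near3 := (@cvg_normRP R k K^o I U FU _ _).1 (xQ (comp_operator (z n) (S - T))) _ e4.
apply: filterS (filterI near1 (filterI near2 near3)) => i [near1i [near2i near3i]].
have -> : f i (T (x i)) + f i (Lam n ((S - T) (x i))) =
    (comp_operator F S + comp_operator (y i) T : dual_space X) (x i) +
    (comp_operator (y i) (Lam n) ((S - T) (x i)) +
     comp_operator (z n) (S - T) (x i)).
  have FST : F ((S - T) (x i)) = F (S (x i)) - F (T (x i)) by rewrite operatorB linearB.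
  change (f i (T (x i)) + f i (Lam n ((S - T) (x i))) =
    F (S (x i)) + (f i (T (x i)) - F (T (x i))) +
    (f i (Lam n ((S - T) (x i))) - F (Lam n ((S - T) (x i))) +
     (F (Lam n ((S - T) (x i))) - F ((S - T) (x i))))).
  by rewrite FST; ring.
have re1 : re ((comp_operator F S + comp_operator (y i) T : dual_space X) (x i)) <= 1 + e / 4.
  rewrite (le_trans (ler_re_normR _))// (le_trans (normR_operator_le1 _ (x1 i)))//.
  by rewrite (le_trans near1i)// lerD2r /y addrC subrK.
have re2 : re (comp_operator (y i) (Lam n) ((S - T) (x i))) <= e / 4.
  rewrite (le_trans (ler_re_normR _))// (le_trans (normR_operator_le _ _))//.
  rewrite [e / 4](_ : _ = e / 4 / 2 * 2); last by rewrite divfK.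
  rewrite ler_pM ?normR_ge0// (le_trans (normR_operator_le _ _))//.
  by rewrite -[2]mulr1 ler_pM ?normR_ge0.
have re3 : re (comp_operator (z n) (S - T) (x i)) <= e / 4 + e / 4.
  rewrite -[comp_operator _ _ _](subrK (Q (comp_operator (z n) (S - T)))) reD lerD//.
  by rewrite (le_trans (ler_re_normR _))// ltW.
have re_le3 (a b c : K) (s1 s2 s3 : R) : re a <= s1 -> re b <= s2 -> re c <= s3 ->
    re (a + (b + c)) <= s1 + (s2 + s3) by move=> *; rewrite !reD !lerD.
by rewrite (le_trans (re_le3 _ _ _ _ _ _ re1 re2 re3))// -addrA -split4.
Qed.

(** Apply [simons] to L |-> T + L (S - T). At vectors and functionals that almost norm
    [A (Lam 0%N)], some [A (Lam n)] has real part at most about 1 by the previous lemma; Simons'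
    inequality transfers this to [Lam 0%N]. The freedom in [D] serves to impose further constraints
    on [L]. *)
Lemma approximant_combination (D : nat -> set 'L(X, X)) S T (e : R) :
  0 < e -> normR S <= 1 -> normR T = 1 ->
  (forall n, D n !=set0) -> (forall n, D n.+1 `<=` D n) ->
  (forall n, closed (D n)) -> (forall n, midconvex (D n)) ->
  (forall n, D n `<=` approximant n) ->
  exists2 L, D 0%N L & normR (T + comp_operator L (S - T)) <= 1 + e.
Proof.
move=> e0 S1 T1 D0 Dsub Dcl Dmid Dapp.
pose A L := T + comp_operator L (S - T).
have e2 : 0 < e / 2 by rewrite divr_gt0.
have e4 : 0 < e / 2 / 2 by rewrite divr_gt0.
have Amid L L' : A (midpoint L L') = midpoint (A L) (A L').
  rewrite /A; set Q := S - T.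
  rewrite (midpointE (h := fun L => comp_operator L Q)); last first.
    by move=> a P P'; exact: comp_operatorPl.
  by rewrite -[T in LHS]midpoint_diag /midpoint -scalerDr addrACA.
have [|Lam [LamD LamA]] := @simons R k X X _ A D (e / 2) e2 Amid D0 Dsub Dcl Dmid.
  by move=> n L /Dapp[].
exists (Lam 0%N) => //; rewrite -/(A _); set u := A (Lam 0%N).
have /choice[x xP] : forall i : nat, exists x, normR x <= 1 /\
    normR u - i.+1%:R^-1 < normR (u x).
  move=> i; have [|x x1 ux] := @normR_operator_approx _ _ _ _ u i.+1%:R^-1.
    by rewrite invr_gt0 ltr0Sn.
  by exists x.
have /choice[f fP] : forall i, exists f : dual_space X, normR f <= 1 /\
    re (f (u (x i))) = normR (u (x i)).
  by move=> i; exact: norming_functional.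
have [U [UU ooU]] := @ultraFilterLemma _ \oo _; have FU := @ultra_proper _ _ UU.
have [n nearn] := @approximant_combination_eventually _ U S T Lam x f (e / 2 / 2)
  UU e4 S1 T1 (fun n => Dapp _ _ (LamD n)) (fun i => (xP i).1) (fun i => (fP i).1).
pose t : R := 2 ^+ n; have t0 : 0 < t by rewrite exprn_gt0.
(* The defect [i.+1%:R^-1] gets multiplied by 2^n, so [i] is taken after [n], far enough for the
   product to stay below e/4. *)
have te : 0 < e / 2 / 2 / t by rewrite divr_gt0.
have [i [ni /ltW ti]] := filter_ex (filterI nearn (ooU _ (near_infty_natSinv_lt (PosNum te)))).
have [xi1 uxi] := xP i; have [fi1 fuxi] := fP i.
have Adist : normR (f i ((ofR k t *: u - A (Lam n)) (x i)) : K^o) <= (t - 1) * normR u + e / 2.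
  rewrite (le_trans (normR_operator_le _ _))// (le_trans (ler_piMl (normR_ge0 _) fi1))//.
  by rewrite (le_trans (normR_operator_le1 _ xi1))// LamA.
have := le_trans (ler_re_normR _) Adist.
rewrite operatorB operatorZ linearB linearZ /= reB re_ofRM fuxi.
have -> : f i (A (Lam n) (x i)) = f i (T (x i)) + f i (Lam n ((S - T) (x i))).
  by rewrite /A operatorD linearD.
move: ni ti uxi; rewrite /= ler_pdivlMr//.
by move=> ni ti uxi tu; apply: near_maximum_bound t0 ni ti (ltW uxi) tu.
Qed.

End approximants.

(** * The M-ideal property *)

Section norm_approximation.
Variables (R : realType) (k : scalar_kind).
Local Notation K := (scalar_field R k).
Variable E : normedModType K.

Lemma re_functional_approx (w : dual_space E) (e : R) : 0 < e ->
  exists S : E, normR S <= 1 /\ normR w - e <= re (w S).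
Proof.
move=> e0; have [S S1 wS] := normR_operator_approx w e0.
have [r r1 rwS] := rotation (w S).
exists (r *: S); split; first by rewrite normRZ r1 mul1r.
have -> : w (r *: S) = r * w S by rewrite linearZ.
by rewrite rwS ofRK ltW.
Qed.

Lemma re_functional_approx_unit (v : dual_space E) (e : R) : v != 0 -> 0 < e ->
  exists T : E, normR T = 1 /\ normR v - e <= re (v T).
Proof.
move=> v0 e0; have nv : 0 < normR v by rewrite normR_gt0.
(* A tolerance of at most half the norm keeps the value positive, so [T] is nonzero; dividing by its
   norm, at most 1, does not decrease the value. *)
have m0 : 0 < Num.min e (normR v / 2) by rewrite lt_min e0 divr_gt0.
have [T [T1 vT]] := re_functional_approx v m0.
have vT0 : 0 < re (v T).
  rewrite (lt_le_trans _ vT)// subr_gt0 (@le_lt_trans _ _ (normR v / 2))//.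
    by rewrite ge_min lexx orbT.
  by rewrite ltr_pdivrMr// mulr_natr mulr2n ltrDl.
have T0 : 0 < normR T.
  rewrite normR_gt0; apply: contraTN vT0 => /eqP ->.
  by rewrite linear0 -(ofR0 R k) ofRK ltxx.
exists (ofR k (normR T)^-1 *: T); split.
  by rewrite normRZ_ofR ger0_norm ?invr_ge0 ?normR_ge0// mulVf// gt_eqF.
have -> : v (ofR k (normR T)^-1 *: T) = ofR k (normR T)^-1 * v T by rewrite linearZ.
rewrite re_ofRM (@le_trans _ _ (re (v T)))//.
  by rewrite (le_trans _ vT)// lerD2l lerN2 ge_min lexx.
by rewrite mulrC ler_pdivlMr// ler_piMr// ltW.
Qed.

End norm_approximation.

(** The four errors come from almost norming two functionals and from two constraints on [L]; [p]
    and [q] will be the real parts of phi (L S) and phi (L T). *)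
Lemma l1_sum_bound (R : realType) (v w vT wS wT p q c e : R) :
  v - e <= vT -> w - e <= wS -> wS - e <= p -> q - e <= wT ->
  vT + wT + (p - q) <= c + e * c -> v + w <= c + e * c + e *+ 4.
Proof. by rewrite -mulr_natr; lra. Qed.

Theorem theorem3p7 (R : realType) (k : scalar_kind)
    (X : completeNormedModType (scalar_field R k)) :
  separable_space X ->
  property_Mstar X ->
  metric_compact_approximation_property X ->
  M_ideal (compact_operators X).
Proof.
move=> /separable_sequence[d d_dense] Mstar mcap.
pose K := scalar_field R k.
split; [exact: compact_operator_linear_subspace|exact: closed_compact_operators|].
pose I := {L : 'L(X, X) | normR L <= 1}.
pose approx n : set I := [set L | approximant d n (sval L)].
(* The sets [approx n] decrease and are nonempty by the approximation property, so they generate a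
   proper filter. *)
have [U [UU subU]] : exists U : set_system I, UltraFilter U /\ filter_from setT approx `<=` U.
  apply: ultraFilterLemma; apply: filter_from_proper; last first.
    move=> n _; have [L aL] := approximant_exists d n mcap.
    by have [_ L1 _] := aL; exists (exist _ L L1).
  apply: filter_from_filter; first by exists 0%N.
  move=> m n _ _; exists (maxn m n) => // L aL; split.
    by apply: approximant_le aL; exact: leq_maxl.
  by apply: approximant_le aL; exact: leq_maxr.
have FU := @ultra_proper _ _ UU.
have Uapprox n : U (approx n) by apply: subU; exists n.
have /choice[P PP] : forall phi : dual_space 'L(X, X), exists psi : dual_space 'L(X, X),
    forall T, (fun L : I => phi (comp_operator (sval L) T) : K^o) @ U --> (psi T : K^o).
  move=> phi.
  have [|L T|psi [_ psiP]] := @ultra_dual R k 'L(X, X) I U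
    (fun L T => phi (comp_operator (sval L) T)) (normR phi) UU; last by exists psi.
    by move=> L a S T; rewrite comp_operatorPr linearP.
  rewrite (le_trans (normR_operator_le _ _))// ler_wpM2l ?normR_ge0//.
  rewrite (le_trans (normR_comp_operator _ _))// ler_piMl ?normR_ge0//.
  exact: (svalP L).
have P_unique (phi : dual_space 'L(X, X)) T (l : K^o) :
    (fun L : I => phi (comp_operator (sval L) T) : K^o) @ U --> l -> P phi T = l.
  move=> phil; exact: (@cvg_unique _ (@norm_hausdorff _ _) _ _ _ _ (PP phi T)).
have P_compact (phi : dual_space 'L(X, X)) T : compact_operator T -> P phi T = phi T.
  move=> cT; apply: P_unique; apply/cvg_normRP => e e0.
  pose c := normR phi + 1; have c0 : 0 < c by rewrite ltr_wpDl// normR_ge0.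
  have ec : 0 < e / c by rewrite divr_gt0.
  have [n nP] := approximant_compact d_dense cT ec.
  apply: filterS (Uapprox n) => L /nP LT.
  rewrite -linearB (le_lt_trans (normR_operator_le _ _))//.
  rewrite (le_lt_trans (ler_wpM2l (normR_ge0 _) LT))//.
  by rewrite mulrCA gtr_pMr// ltr_pdivrMr// mul1r ltrDl.
have P_annihilator phi : annihilator (compact_operators X) phi -> P phi = 0.
  move=> phi0; apply: operator_eqP => T; apply: P_unique.
  apply/cvg_normRP => e e0; apply: filterS (Uapprox 0%N) => L [cL _ _].
  rewrite (phi0 (comp_operator (sval L) T)); first by rewrite subr0 normR0.
  exact: compact_comp_operator.
have P_linear : linear P.
  move=> a phi psi; apply: operator_eqP => T; apply: P_unique.
  have := cvgD (cvgZl_tmp (k := a) (PP phi T)) (PP psi T).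
  exact.
have PB phi psi : P (phi - psi) = P phi - P psi.
  by rewrite -[- psi]scaleN1r [phi + _]addrC P_linear scaleN1r addrC.
have sub_annihilator phi : annihilator (compact_operators X) (phi - P phi).
  move=> T cT; change (phi T - P phi T = 0); by rewrite P_compact// subrr.
have PK phi : P (P phi) = P phi.
  by apply/eqP; rewrite eq_sym -subr_eq0 -PB P_annihilator.
(* [P] is an idempotent whose kernel is the annihilator, so its range is a complement. *)
exists (range P).
  split; first by exists 0 => //; apply: P_annihilator => T _.
  by move=> a _ _ [phi _ <-] [psi _ <-]; exists (a *: phi + psi) => //; exact: P_linear.
split=> [phi|v w v0 [psi _ wE]].
  exists (phi - P phi, P phi); split=> [|[v w] /= [v0 [psi _ wE] phiE]].
    by split => /=; [exact: sub_annihilator|exists phi|rewrite subrK].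
  have Pw : P w = w by rewrite -wE PK.
  by rewrite phiE -[v]scale1r P_linear P_annihilator// scaler0 add0r Pw addrK.
have Pphi : P (v + w) = w.
  by rewrite -[v]scale1r P_linear P_annihilator// scaler0 add0r -wE PK.
apply/eqP; rewrite eq_le ler_normD/= -!normRK -ofRD ler_ofR.
(* The case v = 0 is separate because [T] has to be a unit vector almost norming [v]. *)
have [->|vn0] := eqVneq v 0; first by rewrite normR0 !add0r.
set phi := v + w in Pphi *.
apply/ler_addgt0Pr => s s0.
have m0 : 0 < normR phi + 4 by rewrite ltr_wpDl// normR_ge0.
(* The total error will be e |phi| + 4 e, whence the denominator. *)
pose e := s / (normR phi + 4); have e0 : 0 < e by rewrite divr_gt0.
have [S [S1 wS]] := re_functional_approx w e0.
have [T [T1 vT]] := re_functional_approx_unit vn0 e0.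
(* Since w = P phi, the condition [C Q] holds along [U] for every [Q], so it can be imposed on [L]
   for both [S] and [T]. *)
pose C Q := [set L : 'L(X, X) | normR (phi (comp_operator L Q) - w Q : K^o) <= e].
have lC Q : linear (fun L : 'L(X, X) => phi (comp_operator L Q) : K^o).
  by move=> a L L'; rewrite comp_operatorPl linearP.
have bC (Q L : 'L(X, X)) : normR (phi (comp_operator L Q) : K^o) <= normR phi * normR Q * normR L.
  rewrite (le_trans (normR_operator_le _ _))// -mulrA ler_wpM2l ?normR_ge0//.
  by rewrite mulrC normR_comp_operator.
have clC Q : closed (C Q).
  exact: (@closed_linear_preimage R k 'L(X, X) K^o _ _ (lC Q) (bC Q) (w Q) e).
have mcC Q : midconvex (C Q).
  exact: (@midconvex_linear_preimage R k 'L(X, X) K^o _ (lC Q) (w Q) e).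
have UC Q : U [set L : I | C Q (sval L)].
  have := (@cvg_normRP R k K^o I U FU _ _).1 (PP phi Q) e e0.
  by rewrite Pphi; apply: filterS => L /ltW.
have [|||||L [_ [CS CT]] Le] := @approximant_combination R k X d d_dense Mstar
    (fun n => approximant d n `&` (C S `&` C T)) S T e e0 S1 T1.
- move=> n.
  have [L [aL [CS CT]]] := filter_ex (filterI (Uapprox n) (filterI (UC S) (UC T))).
  by exists (sval L).
- by move=> n L [aL CL]; split => //; exact: approximant_le aL.
- move=> n; apply: closedI; first exact: closed_approximant.
  by apply: closedI; exact: clC.
- move=> n L L' [aL [CS CT]] [aL' [CS' CT']]; split.
    exact: midconvex_approximant aL aL'.
  by split; exact: mcC.
- by move=> n L [].
have phiL : re (phi (T + comp_operator L (S - T))) <= normR phi + e * normR phi.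
  rewrite (le_trans (ler_re_normR _))// (le_trans (normR_operator_le _ _))//.
  by rewrite (le_trans (ler_wpM2l (normR_ge0 _) Le))// mulrDr mulr1 [normR phi * e]mulrC.
(* By [C S] and [C T] this value is close to v T + w S, as w T almost cancels phi (L T). *)
have phiE : phi (T + comp_operator L (S - T)) =
    v T + w T + (phi (comp_operator L S) - phi (comp_operator L T)).
  by rewrite comp_operatorBr linearD linearB.
have CS' : re (w S) - e <= re (phi (comp_operator L S)).
  by rewrite lerBlDr -lerBlDl -reB (le_trans (ler_re_normR _))// (@distRC R k K^o).
have CT' : re (phi (comp_operator L T)) - e <= re (w T).
  by rewrite lerBlDr -lerBlDl -reB (le_trans (ler_re_normR _)).
have reE (a b c c' : K) : re (a + b + (c - c')) = re a + re b + (re c - re c').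
  by rewrite !reD reN.
rewrite phiE reE in phiL.
rewrite (le_trans (l1_sum_bound vT wS CS' CT' phiL))//.
by rewrite -[e *+ 4]mulr_natr -addrA -mulrDr divfK// gt_eqF.
Qed.
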